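(* For $n\ge1$ and $k\ge0$ let $$\xi^+_{n,k}(\mathbf{x},\mathbf{y})=\sum_{(\lambda,\mu)\vdash n}c^+_{(\lambda,\mu),k}\,s_\lambda(\mathbf{x})s_\mu(\mathbf{y}),\qquad \xi^-_{n,k}(\mathbf{x},\mathbf{y})=\sum_{(\lambda,\mu)\vdash n}c^-_{(\lambda,\mu),k}\,s_\lambda(\mathbf{x})s_\mu(\mathbf{y}),$$ where $c^+_{(\lambda,\mu),k}$ (respectively, $c^-_{(\lambda,\mu),k}$) is the number of bitableaux $\mathcal{P}\in\mathrm{SYT}(\lambda,\mu)$ for which $\mathrm{Asc}_B(\mathcal{P})\in\mathrm{Stab}([2,n])$ has $k$ elements and contains (respectively, does not contain) $n$; let also $\xi^+_{0,0}(\mathbf{x},\mathbf{y})=1$. Then $$\frac{E(\mathbf{x};tz)-tE(\mathbf{x};z)}{E(\mathbf{x};tz)E(\mathbf{y};tz)-tE(\mathbf{x};z)E(\mathbf{y};z)}=\sum_{n\ge0}z^n\sum_{k=0}^{\lfloor n/2\rfloor}\xi^+_{n,k}(\mathbf{x},\mathbf{y})\,t^k(1+t)^{n-2k}$$ and $$\frac{E(\mathbf{x};z)-E(\mathbf{x};tz)}{E(\mathbf{x};tz)E(\mathbf{y};tz)-tE(\mathbf{x};z)E(\mathbf{y};z)}=\sum_{n\ge1}z^n\sum_{k=0}^{\lfloor(n-1)/2\rfloor}\xi^-_{n,k}(\mathbf{x},\mathbf{y})\,t^k(1+t)^{n-1-2k}.$$ Moreover, for $n\ge1$, $$\xi^{+}_{n,k}(\mathbf{x},\mathbf{y})=\sum_wF_{\mathrm{sDes}(w)}(\mathbf{x},\mathbf{y})\qquad\Big(\text{respectively,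 }\ \xi^{-}_{n,k}(\mathbf{x},\mathbf{y})=\sum_wF_{\mathrm{sDes}(w)}(\mathbf{x},\mathbf{y})\Big),$$ where $w\in\mathcal{B}_n$ runs through all signed permutations for which $\mathrm{Asc}_B(w^{-1})\in\mathrm{Stab}([2,n])$ has $k$ elements and contains (respectively, does not contain) $n$.
   Context: Notation: $[m]=\{1,\dots,m\}$, $[a,b]=\{a,\dots,b\}$ (empty if $a>b$); $\mathrm{Stab}(\Theta)$ is the set of subsets of $\Theta\subseteq\mathbb{Z}$ containing no two consecutive integers. $\mathbf{x}=(x_1,x_2,\dots)$, $\mathbf{y}=(y_1,y_2,\dots)$; $E(\mathbf{x};z)=\sum_{n\ge0}e_n(\mathbf{x})z^n$ is the generating function of the elementary symmetric functions; $s_\lambda$ are Schur functions. The identities are between formal power series in $z$ whose coefficients are polynomials in $t$ over the ring of functions symmetric in $\mathbf{x}$ and in $\mathbf{y}$ separately. $\mathcal{B}_n$ is the hyperoctahedral group of signed permutations $w=(w(1),\dots,w(n))$ of $[n]$ (bijections $w$ of $\{\pm1,\dots,\pm n\}$ with $w(-i)=-w(i)$). A bipartition $(\lambda,\mu)\vdash n$ is a pair of integer partitions of total sum $n$. A standard Young bitableau of shape $(\lambda,\mu)\vdash n$ and size $n$ is a pair $\mathcal{P}=(\mathcal{P}^+,\mathcal{P}^-)$ of Young tableaux (entries increasing along rows and columns) of shapes $\lambda$ and $\mu$ such that every element of $[n]$ appears exactly once in $\mathcal{P}^+$ or $\mathcal{P}^-$; $\mathrm{SYT}(\lambda,\mu)$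 is the set of these. For $w\in\mathcal{B}_n$ let $\varepsilon_i\in\{+,-\}$ be the sign of $w(i)$. $\mathrm{Des}(w)$ is the set of $i\in[n-1]$ with either $\varepsilon_i=+$, $\varepsilon_{i+1}=-$, or $\varepsilon_i=\varepsilon_{i+1}$ and $|w(i)|>|w(i+1)|$. $\mathrm{sDes}(w)=(\mathrm{Des}(w),\varepsilon)$ with $\varepsilon=(\varepsilon_1,\dots,\varepsilon_n)$. For a standard Young bitableau $\mathcal{P}$ of size $n$ let $\varepsilon_i$ be the sign of the part ($\mathcal{P}^+$ or $\mathcal{P}^-$) in which $i$ appears; $\mathrm{Des}(\mathcal{P})$ is the set of $i\in[n-1]$ with either $\varepsilon_i=+$, $\varepsilon_{i+1}=-$, or $\varepsilon_i=\varepsilon_{i+1}$ and $i+1$ appears in a lower row than $i$ (English notation). $\mathrm{Des}_B(\mathcal{P})=\mathrm{Des}(\mathcal{P})\cup\{n\}$ if $n$ appears in $\mathcal{P}^+$, and $\mathrm{Des}_B(\mathcal{P})=\mathrm{Des}(\mathcal{P})$ otherwise; $\mathrm{Asc}_B(\mathcal{P})=[n]\smallsetminus\mathrm{Des}_B(\mathcal{P})$. Similarly $\mathrm{Des}_B(w)=\mathrm{Des}(w)\cup\{n\}$ if $w(n)>0$, $\mathrm{Des}_B(w)=\mathrm{Des}(w)$ otherwise, and $\mathrm{Asc}_B(w)=[n]\smallsetminus\mathrm{Des}_B(w)$. For $w\in\mathcal{B}_n$ with $\mathrm{sDes}(w)=(\mathrm{Des}(w),\varepsilon)$, $$F_{\mathrm{sDes}(w)}(\mathbf{x},\mathbf{y})=\sum_{\substack{1\le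 i_1\le i_2\le\cdots\le i_n\\ j\in\mathrm{Des}(w)\Rightarrow i_j<i_{j+1}}}z_{i_1}z_{i_2}\cdots z_{i_n},$$ where $z_{i_j}=x_{i_j}$ if $\varepsilon_j=+$ and $z_{i_j}=y_{i_j}$ if $\varepsilon_j=-$. *)

(* Defs.v *)
From HB Require Import structures.
From mathcomp Require Import all_boot all_order all_algebra.
From mathcomp Require Import fingroup perm fraction finmap multiset.
From mathcomp Require Import boolp classical_sets cardinality fsbigop.

Set Implicit Arguments.
Unset Strict Implicit.
Unset Printing Implicit Defensive.

Import GRing.Theory.
Local Open Scope ring_scope.
Local Open Scope mset_scope.

Section Splits.
Variable V : choiceType.
Implicit Types (m A B : {mset V}).

Definition splits m : {fset {mset V} * {mset V}} :=
  [fset (seq_mset (mask (tval b) m), (m `\` seq_mset (mask (tval b) m))%mset)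
    | b in [set: (size m).-tuple bool]]%fset.

Lemma in_splits m (p : {mset V} * {mset V}) :
  (p \in splits m) = (p.1 `+` p.2 == m).
Proof.
apply/imfsetP/eqP => [[b _ ->] /=|<-].
  rewrite msetBDKC //; apply/msubsetP => x; rewrite mset_seqE -count_mem_mset.
  by apply/count_subseqP: x; exists (mask b m) => //; apply: mask_subseq.
case: p => A B /=.
have : forall x, (count_mem x A <= count_mem x (A `+` B))%N.
  by move=> x; rewrite !count_mem_mset msetE2 leq_addr.
case/count_subseqP => s /subseqP[b sb ->] As.
have sb' : size b == size (A `+` B) by apply/eqP.
exists (Tuple sb'); rewrite ?inE //=.
have <- : A = seq_mset (mask b (A `+` B)).
  by rewrite -[LHS]seq_mset_id; apply/eq_seq_msetP.
by rewrite msetDKB.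
Qed.

End Splits.

(* Formal power series over R in the family of variables V; a monomial is the
   finite multiset of its variables. *)
Record fps (V : choiceType) (R : Type) := FPS { coefps : {mset V} -> R }.

HB.instance Definition _ (V : choiceType) (R : Type) := gen_eqMixin (fps V R).
HB.instance Definition _ (V : choiceType) (R : Type) :=
  gen_choiceMixin (fps V R).

Lemma fpsP (V : choiceType) (R : Type) (f g : fps V R) :
  coefps f =1 coefps g -> f = g.
Proof. by case: f g => [f] [g] /= /funext ->. Qed.

Section FpsZmod.
Variables (V : choiceType) (R : zmodType).
Implicit Types f g h : fps V R.

Definition fps0 : fps V R := FPS (fun=> 0).
Definition fps_opp f := FPS (fun m => - coefps f m).
Definition fps_add f g := FPS (fun m => coefps f m + coefps g m).

Fact fps_addA : associative fps_add.
Proof. by move=> f g h; apply: fpsP => m /=; rewrite addrA. Qed.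
Fact fps_addC : commutative fps_add.
Proof. by move=> f g; apply: fpsP => m /=; rewrite addrC. Qed.
Fact fps_add0 : left_id fps0 fps_add.
Proof. by move=> f; apply: fpsP => m /=; rewrite add0r. Qed.
Fact fps_addN : left_inverse fps0 fps_opp fps_add.
Proof. by move=> f; apply: fpsP => m /=; rewrite addNr. Qed.

HB.instance Definition _ :=
  GRing.isZmodule.Build (fps V R) fps_addA fps_addC fps_add0 fps_addN.

End FpsZmod.

Section FpsRing.
Variables (V : choiceType) (R : comNzRingType).
Implicit Types (f g h : fps V R) (c : R).

Definition fpsC c : fps V R := FPS (fun m => if m == mset0 then c else 0).
Definition fps_mul f g : fps V R :=
  FPS (fun m => \sum_(p <- splits m) coefps f p.1 * coefps g p.2).

Fact fps_mulC : commutative fps_mul.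
Proof.
move=> f g; apply: fpsP => m /=.
pose sw (p : {mset V} * {mset V}) := (p.2, p.1).
have swK : cancel sw sw by case.
rewrite (perm_big (map sw (splits m))) /=.
  by rewrite big_map; apply: eq_bigr => p _; rewrite mulrC.
apply: uniq_perm; rewrite ?(map_inj_uniq (can_inj swK)) ?fset_uniq //.
by move=> p; rewrite -[p in RHS]swK (mem_map (can_inj swK)) !in_splits msetDC.
Qed.

Fact fps_mulA : associative fps_mul.
Proof.
move=> f g h; apply: fpsP => m /=.
pose T3 := ({mset V} * {mset V} * {mset V})%type.
pose F (x : T3) := coefps f x.1.1 * coefps g x.1.2 * coefps h x.2.
pose l1 := [seq ((p.1, q.1), q.2) : T3
             | p <- splits m, q <- splits p.2].
pose l2 := [seq ((q.1, q.2), p.2) : T3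
             | p <- splits m, q <- splits p.1].
transitivity (\sum_(x <- l1) F x).
  rewrite big_allpairs_dep; apply: eq_bigr => p _.
  by rewrite mulr_sumr; apply: eq_bigr => q _; rewrite mulrA.
transitivity (\sum_(x <- l2) F x); last first.
  rewrite big_allpairs_dep; apply: eq_bigr => p _.
  by rewrite mulr_suml; apply: eq_bigr => q _.
apply: perm_big; apply: uniq_perm.
- apply: allpairs_uniq_dep => [|p _|]; rewrite ?fset_uniq //.
  move=> x y /allpairsPdep[[a b] [[c d] [_ h1 ->]]].
  move=> /allpairsPdep[[a' b'] [[c' d'] [_ h2 ->]]] /= [e1 e2 e3].
  move: h1 h2; rewrite !in_splits /= => /eqP <- /eqP <-.
  by rewrite e1 e2 e3.
- apply: allpairs_uniq_dep => [|p _|]; rewrite ?fset_uniq //.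
  move=> x y /allpairsPdep[[a b] [[c d] [_ h1 ->]]].
  move=> /allpairsPdep[[a' b'] [[c' d'] [_ h2 ->]]] /= [e1 e2 e3].
  move: h1 h2; rewrite !in_splits /= => /eqP <- /eqP <-.
  by rewrite e1 e2 e3.
move=> [[a b] c]; apply/allpairsPdep/allpairsPdep => /=.
  move=> [p [q [+ + [-> -> ->]]]]; rewrite !in_splits => /eqP hp /eqP hq.
  exists (p.1 `+` q.1, q.2), (p.1, q.1).
  by rewrite !in_splits /= -msetDA hq hp !eqxx.
move=> [p [q [+ + [-> -> ->]]]]; rewrite !in_splits => /eqP hp /eqP hq.
exists (q.1, q.2 `+` p.2), (q.2, p.2).
by rewrite !in_splits /= msetDA hq hp !eqxx.
Qed.

Fact fps_mul1 : left_id (fpsC 1) fps_mul.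
Proof.
move=> f; apply: fpsP => m /=.
have m0 : (mset0, m) \in splits m by rewrite in_splits /= mset0D.
rewrite (big_fsetD1 _ m0) /= eqxx mul1r big_seq big1 ?addr0 // => p.
rewrite !inE in_splits => /andP[pm /eqP p12]; case: eqP => [p0|]; last first.
  by rewrite mul0r.
by case/eqP: pm; case: p p12 p0 => a b /= <- ->; rewrite mset0D.
Qed.

Fact fps_mulD : left_distributive fps_mul +%R.
Proof.
move=> f g h; apply: fpsP => m /=.
by rewrite -big_split; apply: eq_bigr => p _ /=; rewrite mulrDl.
Qed.

Fact fps1_neq0 : fpsC 1 != 0.
Proof.
apply/eqP => /(congr1 (fun f => coefps f mset0)) /=; rewrite eqxx.
by move/eqP; rewrite oner_eq0.
Qed.

HB.instance Definition _ := GRing.Zmodule_isComNzRing.Build (fps V R)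
  fps_mulA fps_mulC fps_mul1 fps_mulD fps1_neq0.

Lemma coefpsM f g m :
  coefps (f * g) m = \sum_(p <- splits m) coefps f p.1 * coefps g p.2.
Proof. by []. Qed.

Definition fps_unit : pred (fps V R) := fun f => `[< exists g, g * f = 1 >].
Definition fps_inv f : fps V R :=
  if pselect (exists g, g * f = 1) is left e then sval (cid e) else f.

Fact fps_mulVr : {in fps_unit, left_inverse 1 fps_inv *%R}.
Proof.
move=> f /asboolP fu; rewrite /fps_inv; case: pselect => // e.
by case: (cid e).
Qed.
Fact fps_unitP f g : g * f = 1 -> fps_unit f.
Proof. by move=> gf; apply/asboolP; exists g. Qed.
Fact fps_inv_out : {in [predC fps_unit], fps_inv =1 id}.
Proof.
move=> f /negP fu; rewrite /fps_inv; case: pselect => // e.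
by case: fu; apply/asboolP.
Qed.

HB.instance Definition _ := GRing.ComNzRing_hasMulInverse.Build (fps V R)
  fps_mulVr fps_unitP fps_inv_out.

End FpsRing.

Section FpsDomain.
Variables (V : countType) (R : idomainType).
Implicit Types (f g : fps V R).

Let bounded N (m : {mset V}) := forall x, x \in m -> (choice.pickle x < N)%N.
Let shift f (n : nat) v := FPS (fun m => coefps f (m `+` msetn n v)).

Let boundedD N (a b : {mset V}) :
  bounded N (a `+` b) <-> bounded N a /\ bounded N b.
Proof.
split=> [ab|[aN bN] x]; last by rewrite in_msetD => /orP[/aN|/bN].
by split=> x xa; apply: ab; rewrite in_msetD xa ?orbT.
Qed.

Let low N f v : (exists2 m, bounded N m & coefps f m != 0) ->
  exists n, (exists m, [/\ bounded N m, m v = n & coefps f m != 0]) /\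
    forall m, bounded N m -> coefps f m != 0 -> (n <= m v)%N.
Proof.
move=> [m mN fm].
pose P n := `[< exists m, [/\ bounded N m, m v = n & coefps f m != 0] >].
have exP : exists n, P n by exists (m v); apply/asboolP; exists m.
have [n /asboolP Pn n_min] := ex_minnP exP.
by exists n; split=> // m' m'N fm'; apply/n_min/asboolP; exists m'.
Qed.

Let coefpsM_low N f g v a b m : bounded N.+1 m -> choice.pickle v = N -> m v = 0%N ->
  (forall m, bounded N.+1 m -> coefps f m != 0 -> (a <= m v)%N) ->
  (forall m, bounded N.+1 m -> coefps g m != 0 -> (b <= m v)%N) ->
  coefps (f * g) (m `+` msetn (a + b)%N v) =
  coefps (shift f a v * shift g b v) m.
Proof.
move=> mN vN mv af bg; rewrite !coefpsM.
set M := m `+` _.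
have MN : bounded N.+1 M.
  by apply/boundedD; split=> // x; rewrite in_msetn => /andP[_ /eqP->]; rewrite vN.
have nD k1 k2 : msetn (k1 + k2)%N v = msetn k1 v `+` msetn k2 v.
  by apply/msetP => x; rewrite msetE2 !msetnE; case: eqP.
pose s (p : {mset V} * {mset V}) := (p.1 `+` msetn a v, p.2 `+` msetn b v).
have s_inj : injective s.
  move=> [p1 p2] [q1 q2] [/(congr1 (msetB^~ (msetn a v)))].
  by rewrite !msetDKBC => -> /(congr1 (msetB^~ (msetn b v))); rewrite !msetDKBC => ->.
transitivity (\sum_(p <- map s (splits m)) coefps f p.1 * coefps g p.2); last first.
  by rewrite big_map.
pose l : seq ({mset V} * {mset V}) := 
  filter (fun p : {mset V} * {mset V} => p.1 v == a) (splits M).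
transitivity (\sum_(p <- l) coefps f p.1 * coefps g p.2); last first.
  apply/perm_big/uniq_perm; rewrite ?filter_uniq ?map_inj_uniq ?fset_uniq //.
  move=> [A B]; rewrite mem_filter in_splits /=; apply/andP/mapP.
    move=> [/eqP Aa /eqP AB].
    have Bb : B v = b.
      move/(congr1 (fun A : {mset V} => A v)): AB.
      by rewrite !msetE2 msetnxx Aa mv add0n => /addnI.
    have aA : (msetn a v `<=` A)%mset.
      by apply/msubsetP => x; rewrite msetnE; case: eqP => // ->; rewrite Aa.
    have bB : (msetn b v `<=` B)%mset.
      by apply/msubsetP => x; rewrite msetnE; case: eqP => // ->; rewrite Bb.
    exists (A `\` msetn a v, B `\` msetn b v); last by rewrite /s /= !msetBDK.
    rewrite in_splits /=; apply/eqP/msetP => x.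
    move/(congr1 (fun A : {mset V} => A x)): AB; rewrite !msetE2 !msetnE.
    by case: eqP => [->|_]; rewrite ?Aa ?Bb ?mv ?subnn ?subn0 ?addn0.
  move=> [[p q]]; rewrite in_splits /= => /eqP pq [-> ->].
  have : (p `+` q) v = 0%N by rewrite pq.
  rewrite msetE2 => /eqP; rewrite addn_eq0 => /andP[/eqP p0 _].
  by rewrite msetE2 msetnxx p0 add0n eqxx msetDACA pq /M nD.
rewrite /l big_filter [RHS]big_mkcond /= big_seq [RHS]big_seq.
apply: eq_bigr => p; rewrite in_splits => /eqP pM; case: eqP => // /eqP pa.
have [p1N p2N] : bounded N.+1 p.1 /\ bounded N.+1 p.2 by apply/boundedD; rewrite pM.
apply/eqP; rewrite mulf_eq0; apply/norP => -[/(af _ p1N) h1 /(bg _ p2N) h2].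
move/(congr1 (fun A : {mset V} => A v)): pM.
rewrite !msetE2 msetnxx mv add0n => e.
have h3 : (a < p.1 v)%N by rewrite ltn_neqAle eq_sym pa.
by move: (leq_add h3 h2); rewrite e addSn ltnn.
Qed.

Let fps_mul_neq0 N f g : (exists2 m, bounded N m & coefps f m != 0) ->
  (exists2 m, bounded N m & coefps g m != 0) ->
  exists2 m, bounded N m & coefps (f * g) m != 0.
Proof.
elim: N => [|N IHN] in f g *.
  have b0 m : bounded 0 m -> m = mset0.
    by move=> m0; case: (mset_0Vmem m) => // -[x /m0].
  move=> [_ /b0-> f0] [_ /b0-> g0]; exists mset0; first by move=> x; rewrite in_mset0.
  rewrite coefpsM (_ : splits mset0 = [fset (mset0, mset0)]%fset).
    by rewrite big_seq_fset1 mulf_neq0.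
  apply/fsetP => -[a b]; rewrite in_splits !inE /= xpair_eqE.
  apply/eqP/andP => [ab|[/eqP-> /eqP->]]; last by rewrite mset0D.
  have ab0 x : (a x == 0%N) && (b x == 0%N).
    by rewrite -addn_eq0 -msetE2 ab mset0E.
  by split; apply/eqP/msetP => x; case/andP: (ab0 x) => /eqP ax /eqP bx; rewrite mset0E.
case vN : (pickle_inv (T := V) N) => [v|]; last first.
  have bN m : bounded N.+1 m -> bounded N m.
    move=> mN x /mN; rewrite ltnS leq_eqVlt => /predU1P[xN|//].
    by move: vN; rewrite -xN pickleK_inv.
  move=> [mf /bN mfN fm] [mg /bN mgN gm].
  have [||m mN fgm] := IHN f g; [by exists mf|by exists mg|].
  by exists m => // x /mN /ltnW.
have {}vN : choice.pickle v = N.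
  by have := @pickle_invK V N; rewrite vN.
have strip h n : (exists m, [/\ bounded N.+1 m, m v = n & coefps h m != 0]) ->
    exists2 m, bounded N m & coefps (shift h n v) m != 0.
  move=> [m [mN mv hm]]; exists (m `\` msetn n v); last first.
    rewrite /= msetBDK //; apply/msubsetP => x; rewrite msetnE.
    by case: eqP => // ->; rewrite mv.
  move=> x; rewrite in_msetB msetnE; case: eqP => [->|xv xm].
    by rewrite mv ltnn.
  have /mN : x \in m by rewrite in_mset.
  rewrite ltnS leq_eqVlt => /predU1P[xN|//].
  by case: xv; apply: (pcan_inj choice.pickleK); rewrite xN.
move=> /low-/(_ v)[a [af f_min]] /low-/(_ v)[b [bg g_min]].
have [m mN fgm] := IHN _ _ (strip _ _ af) (strip _ _ bg).
have mN1 : bounded N.+1 m by move=> x /mN /ltnW.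
have mv : m v = 0%N.
  by apply/mset_eq0P; apply/negP => /mN; rewrite vN ltnn.
exists (m `+` msetn (a + b)%N v); last by rewrite (coefpsM_low mN1).
apply/boundedD; split=> // x.
by rewrite in_msetn => /andP[_ /eqP->]; rewrite vN.
Qed.

Fact fps_integral : GRing.integral_domain_axiom (fps V R).
Proof.
move=> f g fg; apply/norP => -[f0 g0].
have nz (h : fps V R) : h != 0 -> exists m, coefps h m != 0.
  move=> h0; apply: contrapT => /forallNP hm; case/eqP: h0.
  by apply: fpsP => m; apply/eqP; apply: contrapT => /negP /hm.
have bnd (m : {mset V}) :
    exists N, forall M, (N <= M)%N -> bounded M m.
  exists (\max_(x <- (m : seq V)) choice.pickle x).+1 => M mM x xm.
  by apply: leq_trans mM; rewrite ltnS; apply: leq_bigmax_seq.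
have [mf fm] := nz _ f0; have [mg gm] := nz _ g0.
have [Nf bf] := bnd mf; have [Ng bg] := bnd mg.
case: (@fps_mul_neq0 (maxn Nf Ng) f g).
- by exists mf => //; apply/bf/leq_maxl.
- by exists mg => //; apply/bg/leq_maxr.
by move=> m _; rewrite fg eqxx.
Qed.

HB.instance Definition _ :=
  GRing.ComUnitRing_isIntegral.Build (fps V R) fps_integral.

End FpsDomain.

Section OneVariable.
Variable R : comNzRingType.
Implicit Types a b : nat -> R.

(* \sum_n a_n z^n, the single variable z being tt *)
Definition zseries a : fps unit R := FPS (fun m => a (size m)).

Lemma zseries_inj a b : zseries a = zseries b -> a =1 b.
Proof.
move=> ab n; move/(congr1 (fun f => coefps f (msetn n tt))): ab => /=.
by rewrite enum_msetn size_nseq.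
Qed.

Lemma zseriesM a b :
  zseries a * zseries b = zseries (fun n => \sum_(i < n.+1) a i * b (n - i)%N).
Proof.
apply: fpsP => m; rewrite coefpsM /=.
have sz (A : {mset unit}) : size A = A tt.
  by rewrite -count_mem_mset -count_predT; apply: eq_count => -[].
have mE (A : {mset unit}) : A = msetn (size A) tt.
  by apply/msetP => -[]; rewrite msetnxx sz.
set n := size m.
pose sp (i : 'I_n.+1) : {mset unit} * {mset unit} :=
  (msetn i tt, msetn (n - i)%N tt).
have inj : injective sp.
  move=> i j [/(congr1 (fun A : {mset unit} => A tt))]; rewrite !msetnxx => ij _.
  exact: val_inj.
transitivity (\sum_(p <- map sp (index_enum 'I_n.+1))
    a (size (p.1 : seq unit)) * b (size (p.2 : seq unit))); last first.
  by rewrite big_map; apply: eq_bigr => i _; rewrite /= !enum_msetn !size_nseq.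
apply/perm_big/uniq_perm; rewrite ?(map_inj_uniq inj) ?fset_uniq ?index_enum_uniq //.
move=> -[A B]; rewrite in_splits /=; apply/eqP/mapP => [AB|[i _ [-> ->]]].
  have ABn : (A tt + B tt = n)%N by rewrite /n -AB sz msetE2.
  have An : (A tt < n.+1)%N by rewrite ltnS -ABn leq_addr.
  exists (Ordinal An); rewrite ?mem_index_enum // /sp /= -ABn addKn -!sz.
  by rewrite -!mE.
rewrite [RHS]mE -/n; apply/msetP => -[]; rewrite msetE2 !msetnxx subnKC //.
by rewrite -ltnS.
Qed.

End OneVariable.

(* The infinite sum of the monomials wt a for a in A. The coefficient of a
   monomial counts a fibre of wt; fset_set is empty on infinite sets, but the
   fibres are finite in all the uses below (finite_elem, finite_schur,
   finite_Fsum). *)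
Definition genfun (V T : choiceType) (A : set T) (wt : T -> {mset V}) :
    fps V int :=
  FPS (fun m => (#|` fset_set (A `&` [set a | wt a = m])%classic|)%:R).

(* A sign is a boolean, true being +. The variable (true, i) is x_{i+1} and
   (false, i) is y_{i+1}; likewise i : 'I_n stands for the element i + 1
   of [n] throughout. *)
Notation var := (bool * nat)%type.
Notation xyseries := (fps var int).

(* e_n(x) for b = true and e_n(y) for b = false *)
Definition elem (b : bool) (n : nat) : xyseries :=
  genfun [set s : seq nat | sorted ltn s /\ size s = n]%classic
    (fun s => seq_mset [seq (b, i) | i <- s]).

(* E(x; u z) for b = true and E(y; u z) for b = false *)
Definition E (b : bool) (u : {poly xyseries}) : fps unit {poly xyseries} :=
  zseries (fun n => (elem b n)%:P * u ^+ n).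

Definition is_part (l : seq nat) : bool := sorted geq l && (0%N \notin l).

Definition bipart (n : nat) : set (seq nat * seq nat) :=
  [set p | [/\ is_part p.1, is_part p.2 & (sumn p.1 + sumn p.2)%N = n]]%classic.

(* T is the list of the rows of the tableau, from top to bottom. *)
Definition tableau (row_rel : rel nat) (l : seq nat) (T : seq (seq nat)) : Prop :=
  [/\ shape T = l, all (sorted row_rel) T &
    forall r c, (c < size (nth [::] T r.+1))%N ->
      (nth 0 (nth [::] T r) c < nth 0 (nth [::] T r.+1) c)%N].

(* s_l(x) for b = true and s_l(y) for b = false *)
Definition schur (b : bool) (l : seq nat) : xyseries :=
  genfun [set T | tableau leq l T]%classic
    (fun T => seq_mset [seq (b, i) | i <- flatten T]).

Definition bitableau : Type := seq (seq nat) * seq (seq nat).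

Definition SYT (n : nat) (p : seq nat * seq nat) : set bitableau :=
  [set P | [/\ tableau ltn p.1 P.1, tableau ltn p.2 P.2 &
     perm_eq (flatten P.1 ++ flatten P.2) (iota 0 n)]]%classic.

Section Descents.
Variable n : nat.
Implicit Types (i j : 'I_n) (eps : {ffun 'I_n -> bool}) (S : {set 'I_n}).

Definition desc eps (down : rel 'I_n) : {set 'I_n} :=
  [set i : 'I_n | [exists j : 'I_n, (j == i.+1 :> nat) &&
    (eps i && ~~ eps j || (eps i == eps j) && down i j)]].

Definition ascB (sD : {set 'I_n} * {ffun 'I_n -> bool}) : {set 'I_n} :=
  ~: (sD.1 :|: [set i : 'I_n | (i.+1 == n) && sD.2 i]).

Definition sDes_tab (P : bitableau) : {set 'I_n} * {ffun 'I_n -> bool} :=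
  let eps := [ffun i : 'I_n => (i : nat) \in flatten P.1] in
  let row i := find (fun r => (i : nat) \in r) (if eps i then P.1 else P.2) in
  (desc eps (fun i j => row i < row j)%N, eps).

(* The letter (true, i) is i + 1, and (false, i) is -(i + 1). *)
Definition letter_opp (a : bool * 'I_n) : bool * 'I_n := (~~ a.1, a.2).

Definition hyperoct : {set {perm bool * 'I_n}} :=
  [set w : {perm bool * 'I_n} | [forall a, w (letter_opp a) == letter_opp (w a)]].

Definition sDes (w : {perm bool * 'I_n}) : {set 'I_n} * {ffun 'I_n -> bool} :=
  let eps := [ffun i : 'I_n => (w (true, i)).1] in
  (desc eps (fun i j => (w (true, j)).2 < (w (true, i)).2)%N, eps).

Definition Stab (Theta : {set 'I_n}) : {set {set 'I_n}} :=
  [set S : {set 'I_n} | (S \subset Theta) &&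
    [forall i in S, forall j in S, (j : 'I_n) != (i : 'I_n).+1 :> nat]].

(* S is in Stab([2, n]), has k elements, and contains n iff top is true. *)
Definition stab_k (top : bool) (k : nat) S : bool :=
  [&& S \in Stab [set i : 'I_n | 0 < i]%N, #|S| == k &
      [exists i in S, (i : 'I_n).+1 == n] == top].

Definition Fsum (sD : {set 'I_n} * {ffun 'I_n -> bool}) : xyseries :=
  genfun [set s : n.-tuple nat | sorted leq s /\
            forall i j, i \in sD.1 -> j = i.+1 :> nat ->
              (tnth s i < tnth s j)%N]%classic
    (fun s => seq_mset [seq (sD.2 j, tnth s j) | j : 'I_n]).

End Descents.

Definition cnum (top : bool) (n k : nat) (p : seq nat * seq nat) : nat :=
  #|` fset_set [set P | SYT n p P /\ stab_k top k (ascB (sDes_tab n P))]%classic|.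

Definition xi (top : bool) (n k : nat) : xyseries :=
  \sum_(p \in bipart n) (schur true p.1 * schur false p.2) *+ cnum top n k p.

(* only k = 0 is used when n = 0 *)
Definition xi_plus (n k : nat) : xyseries :=
  if n == 0%N then (k == 0%N)%:R else xi true n k.

(* used for n >= 1 only *)
Definition xi_minus (n k : nat) : xyseries := xi false n k.

Section Finiteness.

Lemma finite_seqs (T : eqType) (l : seq T) n :
  finite_set [set s : seq T | size s = n /\ {subset s <= l}]%classic.
Proof.
elim: n => [|n IHn].
  by apply: (sub_finite_set _ (finite_set1 [::])) => s [/size0nil-> _].
have fl : finite_set [set x | x \in l]%classic by apply: finite_seq.
apply: sub_finite_set (finite_image (fun p => p.1 :: p.2) (finite_setX fl IHn)).
move=> [|x s] [] //= [sn] sl; exists (x, s) => //=; split=> /=.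
  by apply: sl; rewrite mem_head.
by split=> // y ys; apply: sl; rewrite inE ys orbT.
Qed.

Let finite_fibre (b : bool) (m : {mset var}) :
  finite_set [set s : seq nat | seq_mset [seq (b, i) : var | i <- s] = m]%classic.
Proof.
apply: sub_finite_set (finite_seqs [seq v.2 | v <- (m : seq var)] (size m)).
move=> s /= sm; have ms : perm_eq m [seq (b, i) | i <- s].
  by rewrite -sm; apply: perm_eq_seq_mset.
split; first by rewrite (perm_size ms) size_map.
move=> i si; apply/mapP; exists (b, i) => //.
by rewrite (perm_mem ms) map_f.
Qed.

Lemma finite_elem b n m : finite_set
  ([set s : seq nat | sorted ltn s /\ size s = n] `&`
   [set s : seq nat | seq_mset [seq (b, i) : var | i <- s] = m])%classic.
Proof. exact: sub_finite_set (@subIsetr _ _ _) (finite_fibre b m). Qed.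

Lemma finite_schur b l m : finite_set
  ([set T : seq (seq nat) | tableau leq l T] `&`
   [set T : seq (seq nat) | seq_mset [seq (b, i) : var | i <- flatten T] = m])%classic.
Proof.
apply: sub_finite_set (finite_image (reshape l) (finite_fibre b m)).
by move=> T [[<- _ _] Tm]; exists (flatten T) => //; apply: flattenK.
Qed.

Lemma finite_Fsum n (sD : {set 'I_n} * {ffun 'I_n -> bool}) m : finite_set
  ([set s : n.-tuple nat | sorted leq s /\
      forall i j : 'I_n, i \in sD.1 -> j = i.+1 :> nat ->
        (tnth s i < tnth s j)%N] `&`
   [set s : n.-tuple nat | seq_mset [seq ((sD.2 j, tnth s j) : var) | j : 'I_n] = m])%classic.
Proof.
apply: sub_finite_set (@subIsetr _ _ _) _.
pose B := [set s : seq nat | size s = n /\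
  {subset s <= [seq v.2 | v <- (m : seq var)]}]%classic.
have fB : finite_set (@tval n nat @^-1` B)%classic.
  by apply: finite_preimage (finite_seqs _ _) => s t _ _; apply: val_inj.
apply: sub_finite_set fB => s /= sm; split; first exact: size_tuple.
move=> x /tnthP[j ->]; apply/mapP; exists (sD.2 j, tnth s j) => //.
rewrite -sm (perm_mem (perm_eq_seq_mset _)).
by apply/mapP; exists j; rewrite ?mem_enum.
Qed.

Lemma finite_SYT n p : finite_set (SYT n p).
Proof.
have fle : finite_set
    (\bigcup_(k in `I_n.+1) [set s : seq nat | size s = k /\ {subset s <= iota 0 n}])%classic.
  by apply: bigcup_finite => // k _; apply: finite_seqs.
apply: sub_finite_set (finite_image
  (fun q => (reshape p.1 q.1, reshape p.2 q.2)) (finite_setX fle fle)).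
move=> [P Q] [[/= sP _ _] [/= sQ _ _] PQ].
exists (flatten P, flatten Q); last by rewrite /= -sP -sQ !flattenK.
have sz : (size (flatten P) + size (flatten Q) = n)%N.
  by rewrite -size_cat (perm_size PQ) size_iota.
split; [exists (size (flatten P))|exists (size (flatten Q))]; rewrite /= ?ltnS.
- by rewrite -sz leq_addr.
- by split=> // x xP; rewrite -(perm_mem PQ) mem_cat xP.
- by rewrite -sz leq_addl.
- by split=> // x xP; rewrite -(perm_mem PQ) mem_cat xP orbT.
Qed.

Lemma finite_bipart n : finite_set (bipart n).
Proof.
have fle : finite_set
    (\bigcup_(k in `I_n.+1) [set s : seq nat | size s = k /\ {subset s <= iota 0 n.+1}])%classic.
  by apply: bigcup_finite => // k _; apply: finite_seqs.
apply: sub_finite_set (finite_setX fle fle) => -[l m] [/= lP mP lm].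
have part_le k s : is_part s -> (sumn s <= k)%N ->
    (size s <= k)%N /\ (forall y, y \in s -> (y <= k)%N).
  move=> /andP[_]; elim: s k => [|x s IHs] k //=.
  rewrite inE negb_or => /andP[x0 s0] sk.
  have xk : (x <= k)%N by apply: leq_trans sk; rewrite leq_addr.
  have [sz ss] : (size s <= k - x)%N /\ (forall y, y \in s -> (y <= k - x)%N).
    by apply: IHs => //; rewrite leq_subRL.
  split=> [|y].
    apply: leq_ltn_trans sz _; rewrite ltn_subrL lt0n eq_sym x0 /=.
    by apply: leq_trans xk; rewrite lt0n eq_sym.
  by rewrite inE => /predU1P[->//|/ss h]; apply: leq_trans h (leq_subr _ _).
split; [exists (size l)|exists (size m)] => //=.
- by rewrite ltnS; apply: (part_le n l lP _).1; rewrite -lm leq_addr.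
- split=> // x xl; rewrite -[_ :: _]/(iota 0 n.+1) mem_iota ltnS; apply: (part_le n l lP _).2 => //.
  by rewrite -lm leq_addr.
- by rewrite ltnS; apply: (part_le n m mP _).1; rewrite -lm leq_addl.
- split=> // x xm; rewrite -[_ :: _]/(iota 0 n.+1) mem_iota ltnS; apply: (part_le n m mP _).2 => //.
  by rewrite -lm leq_addl.
Qed.

End Finiteness.

Lemma elem0 b : elem b 0 = 1.
Proof.
have nilE (s : seq nat) : sorted ltn s /\ size s = 0%N <-> s = [::].
  by split=> [[_ /size0nil]|->].
have nil0 : seq_mset [seq (b, i) | i <- ([::] : seq nat)] = mset0.
  by apply/msetP => v; rewrite mset_seqE mset0E.
apply: fpsP => m.
rewrite (_ : coefps 1 m = if m == mset0 then 1 else 0) //= /elem /=.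
have [->|m0] := eqVneq m mset0.
  rewrite (_ : (_ `&` _)%classic = [set [::]]%classic) ?fset_set1 ?cardfs1 //.
  by apply/seteqP; split=> s /= => [[/nilE]|->].
rewrite (_ : (_ `&` _)%classic = set0) ?fset_set0 ?cardfs0 //.
rewrite -subset0 => s [/= /nilE-> /esym]; rewrite nil0 => /eqP.
by rewrite (negPf m0).
Qed.

(* The denominator common to both quotients: dividing by it in the fraction
   field is meaningful. *)
Lemma den_neq0 : E true 'X * E false 'X -
  fpsC unit 'X * E true 1 * E false 1 != 0.
Proof.
have fpsCz (c : {poly xyseries}) :
    fpsC unit c = zseries (fun n => if n == 0%N then c else 0).
  by apply: fpsP => m /=; rewrite -size_mset_eq0.
rewrite subr_eq0 /E fpsCz !zseriesM; apply/eqP => /zseries_inj/(_ 0%N).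
rewrite !(big_ord_recl, big_ord0, addr0) /= !elem0 !expr0 !mulr1 => /esym.
move/(congr1 (fun p : {poly xyseries} => p`_0)).
by rewrite coefX coef1 => /eqP; rewrite eq_sym oner_eq0.
Qed.

(* Main.v *)
(* Order the letters of the signed alphabet by y_i < 0 < x_j. A word of length n
   followed by a final 0 has ascent set Asc_B, and both descriptions of xi_{n,k}
   turn out to enumerate the words whose ascent set is stable with k elements:
   for bitableaux by row insertion (positive letters into one tableau, negative
   ones into the other), for signed permutations by standardization.

   Let R(p) enumerate the words with ascent pattern p. Cutting a word after its
   m-th letter gives e_m(x,y) R(p) = R(d..d a p) + R(d..d d p), with m-1 letters
   d (descent) before the displayed a (ascent) or d. Multiplying the right-hand
   sides of the theorem by the denominator, whose coefficients are
   (t^m - t) e_m(x,y), therefore reduces to an identity between the weights of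
   bit sequences: in a stable pattern a descending run of length m that ends with
   an ascent contributes u(m) = t (1+t)^(m-2), and sum_m (t^m - t) u(r-m) = 0. *)
Require Import Defs.
From mathcomp Require Import all_boot all_order all_algebra all_fingroup zify ring.
From mathcomp Require Import fraction finmap multiset boolp classical_sets.
From mathcomp Require Import cardinality fsbigop.
Import GRing.Theory.

Set Implicit Arguments.
Unset Strict Implicit.
Unset Printing Implicit Defensive.

Local Open Scope mset_scope.
Local Open Scope nat_scope.

(** * Row insertion *)

(** The weights t^k (1+t)^(n-2k) and t^k (1+t)^(n-1-2k) are products over descending runs. Stability
    forces a run that ends with an ascent to have length m >= 2, and it takes u(m); a last run of
    length m that descends to 0 takes (1+t)^(m-1). With u(0) = 1 and u(1) = 0, sum_m u(m) z^m =
    (1-z)(1-tz)/(1-(1+t)z), which is 1-t divided by sum_m (t^m - t) z^m: hence the cancellation. The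
    numerators come from the only pattern without ascent. Descending to 0 forces all letters to be
    positive, so its enumerator is e_n(x), and its coefficient is t^n - t or 1 - t^n. Insertion fits
    because row bumping turns the descents of a word into those of the recording tableau; between
    opposite signs, and before the final 0, only signs matter. The recording bitableau is stored as
    the word of signs and rows of the successive new boxes, so that letters and tableaux share one
    notion of ascent flags. *)

Definition column_strict (s1 s2 : seq nat) : Prop :=
  size s2 <= size s1 /\ forall c, c < size s2 -> nth 0 s1 c < nth 0 s2 c.

(** Recursive on rows so that induction follows the bumping path. Excluding empty rows makes the
    shape determine the number of rows. *)
Fixpoint semistandard (T : seq (seq nat)) : Prop :=
  if T is s :: T' then [/\ sorted leq s, 0 < size s,
    column_strict s (head [::] T') & semistandard T']
  else True.

Definition bump_pos (x : nat) (s : seq nat) : nat := find (ltn x) s.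
Definition row_insert (x : nat) (s : seq nat) : seq nat := set_nth 0 s (bump_pos x s) x.

(** The first component is the row of the new box, which is all that the recording word needs. *)
Fixpoint insert (x : nat) (T : seq (seq nat)) : nat * seq (seq nat) :=
  if T is s :: T' then
    if bump_pos x s < size s then
      let q := insert (nth 0 s (bump_pos x s)) T' in (q.1.+1, row_insert x s :: q.2)
    else (0, row_insert x s :: T')
  else (0, [:: [:: x]]).

Lemma sorted_leq_nthP (s : seq nat) :
  reflect (forall i j, i <= j -> j < size s -> nth 0 s i <= nth 0 s j) (sorted leq s).
Proof.
apply: (iffP idP) => [ss i j ij js|h].
  by apply: (sorted_leq_nth leq_trans leqnn) => //; rewrite inE; lia.
by apply/(sortedP 0) => i is_; apply: h.
Qed.

Lemma bump_pos_le x s : bump_pos x s <= size s.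
Proof. exact: find_size. Qed.

Lemma nth_ltn_bump_pos x s c : c < bump_pos x s -> nth 0 s c <= x.
Proof. by move=> /(before_find 0) /=; lia. Qed.

Lemma nth_bump_pos x s : bump_pos x s < size s -> x < nth 0 s (bump_pos x s).
Proof. by rewrite -has_find => /(nth_find 0). Qed.

Lemma bump_posP x s i : i <= size s -> (forall c, c < i -> nth 0 s c <= x) ->
  (i < size s -> x < nth 0 s i) -> bump_pos x s = i.
Proof.
move=> si lo hi; have := bump_pos_le x s.
case: (ltngtP (bump_pos x s) i) => // h hs.
  have := lo _ h; have /nth_bump_pos : bump_pos x s < size s by lia.
  lia.
have := nth_ltn_bump_pos h; have : x < nth 0 s i by apply: hi; lia.
lia.
Qed.

Lemma size_row_insert x s :
  size (row_insert x s) = (bump_pos x s == size s) + size s.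
Proof. by rewrite size_set_nth; have := bump_pos_le x s; lia. Qed.

Lemma nth_row_insert x s c :
  nth 0 (row_insert x s) c = if c == bump_pos x s then x else nth 0 s c.
Proof. by rewrite nth_set_nth. Qed.

Lemma sorted_row_insert x s : sorted leq s -> sorted leq (row_insert x s).
Proof.
move=> /sorted_leq_nthP ss; apply/sorted_leq_nthP => i j ij.
rewrite size_row_insert !nth_row_insert => js; have := bump_pos_le x s.
have [e|ni] := eqVneq i (bump_pos x s);
  have [e'|nj] := eqVneq j (bump_pos x s) => // isz.
- have /nth_bump_pos : bump_pos x s < size s by lia.
  have := ss (bump_pos x s) j; lia.
- have := @nth_ltn_bump_pos x s i; lia.
- apply: ss; lia.
Qed.

Lemma head_insert x T : head [::] (insert x T).2 = row_insert x (head [::] T).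
Proof. by case: T => [|s T] //=; case: ifP. Qed.

(** A bumping path moves weakly to the left: the entry below the bumped one, if any, is larger than
    it. *)
Lemma bump_pos_column_strict s1 s2 x : sorted leq s1 -> column_strict s1 s2 ->
  bump_pos x s1 < size s1 ->
  bump_pos (nth 0 s1 (bump_pos x s1)) s2 <= bump_pos x s1.
Proof.
move=> ss [sz d] i1; rewrite leqNgt; apply/negP => h.
have := nth_ltn_bump_pos h; have := bump_pos_le (nth 0 s1 (bump_pos x s1)) s2.
have := d (bump_pos x s1); lia.
Qed.

(** The bumped entry lands weakly left of its old column, under an entry at most [x], and [x] is
    smaller than it. Under [x] itself stands the bumped entry or something larger. *)
Lemma column_strict_row_insert s1 s2 x : sorted leq s1 -> column_strict s1 s2 ->
  bump_pos x s1 < size s1 ->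
  column_strict (row_insert x s1) (row_insert (nth 0 s1 (bump_pos x s1)) s2).
Proof.
move=> ss d i1; have j_i := bump_pos_column_strict ss d i1; have xy := nth_bump_pos i1.
case: d => sz d; split; first by rewrite !size_row_insert; have := bump_pos_le x s1;
  lia.
move=> c; rewrite size_row_insert !nth_row_insert => cs.
have [e1|n1] := eqVneq c (bump_pos x s1); have [e2|n2] := eqVneq c _ => //.
- have := d (bump_pos x s1); rewrite e1;
  have := bump_pos_le (nth 0 s1 (bump_pos x s1)) s2; lia.
- have := @nth_ltn_bump_pos x s1 c; lia.
- apply: d; have := bump_pos_le (nth 0 s1 (bump_pos x s1)) s2; lia.
Qed.

Lemma column_strict_row_insert_end s1 s2 x : column_strict s1 s2 ->
  size s1 <= bump_pos x s1 -> column_strict (row_insert x s1) s2.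
Proof.
move=> [sz d] i1; split=> [|c cs]; first by rewrite size_row_insert; lia.
by rewrite nth_row_insert; case: eqP => [e|_]; [lia|apply: d].
Qed.

Lemma semistandard_insert x T : semistandard T -> semistandard (insert x T).2.
Proof.
elim: T x => [|s T IH] x //= [ss s0 d tT]; case: ltnP => i1 /=.
  split; [exact: sorted_row_insert|rewrite size_row_insert; lia| |exact: IH].
  by rewrite head_insert; apply: column_strict_row_insert.
split=> //; [exact: sorted_row_insert|rewrite size_row_insert;
  lia|exact: column_strict_row_insert_end].
Qed.

Lemma perm_row_insert x s : bump_pos x s < size s ->
  perm_eq (nth 0 s (bump_pos x s) :: row_insert x s) (x :: s).
Proof.
move=> i1; rewrite /row_insert set_nthE i1 -[s in X in perm_eq _ X](cat_take_drop
  (bump_pos x s)).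
rewrite [drop (bump_pos x s) s](drop_nth 0 i1).
by apply/seq.permP => p; rewrite /= !count_cat /=; lia.
Qed.

Lemma row_insert_end x s : size s <= bump_pos x s -> row_insert x s = rcons s x.
Proof.
move=> i1; rewrite /row_insert (_ : bump_pos x s = size s);
  last by have := bump_pos_le x s; lia.
by elim: s {i1} => //= y s ->.
Qed.

Lemma perm_insert x T : perm_eq (flatten (insert x T).2) (x :: flatten T).
Proof.
elim: T x => [|s T IH] x //=; case: ltnP => i1 /=.
  apply/seq.permP => p; have /seq.permP/(_ p) := perm_row_insert i1.
  have /seq.permP/(_ p) := IH (nth 0 s (bump_pos x s)); rewrite /= !count_cat; lia.
rewrite row_insert_end //; apply/seq.permP => p.
by rewrite /= !count_cat -cats1 count_cat /=; lia.
Qed.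

Lemma shape_insert x T r :
  nth 0 (shape (insert x T).2) r = nth 0 (shape T) r + (r == (insert x T).1).
Proof.
elim: T x r => [|s T IH] x [|r] //=; rewrite ?nth_nil //; case: ltnP => i1 //=.
- by rewrite size_row_insert ltn_eqF // addn0.
- by rewrite size_row_insert eqn_leq i1 bump_pos_le addnC.
by rewrite addn0.
Qed.

Lemma bump_pos_mono x y s : y < x -> bump_pos y s <= bump_pos x s.
Proof.
move=> yx; rewrite leqNgt; apply/negP => h; have := nth_ltn_bump_pos h.
have /nth_bump_pos : bump_pos x s < size s by have := bump_pos_le y s; lia.
lia.
Qed.

Lemma bump_pos_row_insert_lt x y s : y < x ->
  bump_pos y (row_insert x s) = bump_pos y s.
Proof.
move=> yx; have yx' := bump_pos_mono s yx; have := bump_pos_le y s;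
  have := bump_pos_le x s => hx hy.
apply: bump_posP; first by rewrite size_row_insert; lia.
  move=> c cy; rewrite nth_row_insert; case: eqP => [e|_]; first by lia.
  exact: nth_ltn_bump_pos.
by move=> _; rewrite nth_row_insert; case: eqP => // ne; apply: nth_bump_pos; lia.
Qed.

Lemma bump_pos_row_insert_ge x y s : x <= y ->
  bump_pos x s < bump_pos y (row_insert x s).
Proof.
move=> xy; rewrite ltnNge; apply/negP => h; have hx := bump_pos_le x s.
have /nth_bump_pos : bump_pos y (row_insert x s) < size (row_insert x s) by rewrite
  size_row_insert; lia.
rewrite nth_row_insert; case: eqP => [|ne]; first by lia.
have /nth_ltn_bump_pos : bump_pos y (row_insert x s) < bump_pos x s by lia.
lia.
Qed.

(** The comparison passes to the bumped entries. If [y < x], then [y] bumps at or left of the place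
    of [x], hence an entry at most [x]; if [x <= y], it acts strictly to the right, where entries
    are at least the one bumped by [x]. *)
Lemma row_bumping x y T : semistandard T ->
  ((insert x T).1 < (insert y (insert x T).2).1) = (y < x).
Proof.
elim: T x y => [|s T IH] x y /=; first by rewrite /bump_pos /=; case: (y < x).
move=> [/sorted_leq_nthP ss _ _ tT]; have hx := bump_pos_le x s;
  have hy := bump_pos_le y (row_insert x s).
have [yx|xy] := ltnP y x.
  have e := bump_pos_row_insert_lt s yx; have yx' := bump_pos_mono s yx.
  case: ifP => i1 /=; rewrite e size_row_insert; last first.
    by rewrite (_ : bump_pos y s < _) //; lia.
  rewrite (_ : bump_pos y s < _) /=; last by lia.
  rewrite ltnS IH // nth_row_insert; have := nth_bump_pos i1; case: eqP => // ne.
  by have := @nth_ltn_bump_pos x s (bump_pos y s); lia.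
have lt := bump_pos_row_insert_ge s xy.
case: ifP => i1 /=; case: ifP; rewrite //= size_row_insert => i2; last by lia.
rewrite ltnS IH // nth_row_insert;
  have := ss (bump_pos x s) (bump_pos y (row_insert x s)).
by case: eqP => [|_]; lia.
Qed.

Lemma insert_inj x1 x2 T1 T2 : semistandard T1 -> semistandard T2 ->
  insert x1 T1 = insert x2 T2 ->
  x1 = x2 /\ T1 = T2.
Proof.
elim: T1 T2 x1 x2 => [|s1 T1 IH] [|s2 T2] x1 x2 /=; first by move=> _ _ [->].
- move=> _ [_ s20 _ _]; case: ltnP => i1 [] //;
  rewrite row_insert_end // => /(congr1 size) /=; rewrite size_rcons; lia.
- move=> [_ s10 _ _] _; case: ltnP => i1 [] //;
  rewrite row_insert_end // => /(congr1 size) /=; rewrite size_rcons; lia.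
move=> [/sorted_leq_nthP ss1 _ _ t1] [/sorted_leq_nthP ss2 _ _ t2].
case: ltnP => i1; case: ltnP => i2 //=; last first.
  by move=> [+ ->]; rewrite !row_insert_end // => /rcons_inj[-> ->].
move=> [er e eT].
have [ey ->] := IH _ _ _ t1 t2 (etrans (surjective_pairing _)
  (etrans (congr2 pair er eT) (esym (surjective_pairing _)))).
have sz : size s1 = size s2 by move/(congr1 size): e; rewrite !size_row_insert; lia.
have en c : nth 0 (row_insert x1 s1) c = nth 0 (row_insert x2 s2) c by rewrite e.
(* The bumped entry is common to both rows. If the first position were smaller, [x2] would stand in
   [s1] to the right of that entry, which exceeds [x2], against sortedness. *)
have ei : bump_pos x1 s1 = bump_pos x2 s2.
  have := nth_bump_pos i1; have := nth_bump_pos i2.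
  have := en (bump_pos x1 s1); have := en (bump_pos x2 s2);
    rewrite !nth_row_insert !eqxx.
  have := ss1 (bump_pos x1 s1) (bump_pos x2 s2);
    have := ss2 (bump_pos x2 s2) (bump_pos x1 s1).
  case: (ltngtP (bump_pos x1 s1) (bump_pos x2 s2)) => //; lia.
have ex : x1 = x2 by have := en (bump_pos x1 s1); rewrite !nth_row_insert -ei !eqxx.
split=> //; congr cons; apply: (@eq_from_nth _ 0) => // c cs.
have := en c; rewrite !nth_row_insert -ei; case: eqP => // -> _.
by rewrite ey ei.
Qed.

(** Reverse bumping: the size hypothesis says that the last box of row [r] is a removable corner. *)
Lemma insert_surj r T : semistandard T ->
  size (nth [::] T r.+1) < size (nth [::] T r) ->
  exists x T0, semistandard T0 /\ insert x T0 = (r, T).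
Proof.
elim: r T => [|r IH] [|s T] //= [ss s0 d tT].
  rewrite nth0 => h; have := h.
  (* In the top row the last entry was appended without bumping, so it is simply removed. *)
  case/lastP: s ss s0 d h => // s x; rewrite size_rcons => ss s0 d _.
  move=> h; exists x; have [s_0|s_gt0] := posnP (size s).
    move/size0nil: s_0 h d => -> /=; exists [::]; split=> //=.
    by case: T tT h d => //= t T [] _; case: (size t).
  exists (s :: T) => /=; have ss' : sorted leq s.
    by move: ss; rewrite -cats1 => /cat_sorted2[].
  split.
    split=> //; case: d => _ d; split; first by lia.
    by move=> c cs; have := d c cs; rewrite nth_rcons ifT //; lia.
  have e : bump_pos x s = size s.
    apply: bump_posP; rewrite ?leqnn ?ltnn // => c cs.
    move/sorted_leq_nthP: ss => /(_ c (size s));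
      rewrite size_rcons !nth_rcons cs ltnn eqxx.
    by apply=> //; lia.
  by rewrite e ltnn row_insert_end // e.
move=> /(IH _ tT)[y [T0 [t0 e]]].
pose j := bump_pos y (head [::] T0).
have hT : head [::] T = row_insert y (head [::] T0) by rewrite -head_insert e.
have jT : j < size (head [::] T).
  by rewrite hT size_row_insert; have := bump_pos_le y (head [::] T0); rewrite -/j; lia.
have yT : nth 0 (head [::] T) j = y by rewrite hT nth_row_insert eqxx.
have [dz dlt] := d.
have jy : nth 0 s j < y by have := dlt j jT; rewrite yT.
move/sorted_leq_nthP: ss => ss.
(* [y] was bumped out of [s] by the rightmost entry smaller than [y], at index [i]. It exists
   because the entry above [y] in column [j] is smaller than [y]. *)
pose k := find (leq y) s; pose i := k.-1.
have lo c : c < k -> nth 0 s c < y by move=> /(before_find 0) /=; lia.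
have hi c : k <= c -> c < size s -> y <= nth 0 s c.
  move=> kc cs; have /(nth_find 0) /= : has (leq y) s by rewrite has_find -/k; lia.
  by rewrite -/k; have := ss k c; lia.
have jk : j < k by rewrite ltnNge; apply/negP => kj; have := hi j kj; lia.
have ks : k <= size s by apply: find_size.
have iy : nth 0 s i < y by apply: lo; lia.
have e0 c : nth 0 (set_nth 0 s i y) c = if c == i then y else nth 0 s c by rewrite
  nth_set_nth.
have sz0 : size (set_nth 0 s i y) = size s by rewrite size_set_nth; lia.
have ei : bump_pos (nth 0 s i) (set_nth 0 s i y) = i.
  apply: bump_posP; rewrite ?sz0; first by lia.
    by move=> c ci; rewrite e0; case: eqP => [|_]; [lia|apply: ss; lia].
  by rewrite e0 eqxx.
exists (nth 0 s i), (set_nth 0 s i y :: T0); split; last first.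
  rewrite /= ei sz0 (_ : i < size s); last by lia.
  rewrite e0 eqxx e /=; congr (_, _ :: _); apply: (@eq_from_nth _ 0).
    by rewrite size_row_insert ei sz0; lia.
  by move=> c _; rewrite nth_row_insert ei e0; case: eqP => // ->.
have t0h : sorted leq (head [::] T0) by case: T0 t0 {e hT} @j jT yT jy jk => //= ? ? [].
split=> //; last first.
(* [y] returns to column [i >= j], and in the head of [T0] all entries from column [j] on exceed
   [y]. *)
- split=> [|c ch]; first by move: dz; rewrite sz0 hT size_row_insert; lia.
  have jh : j = bump_pos y (head [::] T0) by [].
  rewrite e0; case: eqP => [ec|nc].
    move/sorted_leq_nthP: t0h => /(_ j c); have : y < nth 0 (head [::] T0) j.
      by apply: nth_bump_pos; lia.
    lia.
  have := dlt c; rewrite hT size_row_insert nth_row_insert -jh;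
    have [ec|_] := eqVneq c j; last by lia.
  have : y < nth 0 (head [::] T0) j by apply: nth_bump_pos; lia.
  by rewrite ec; lia.
- by rewrite sz0; lia.
apply/sorted_leq_nthP => a b ab; rewrite sz0 !e0 => bs.
have [ea|na] := eqVneq a i; have [eb|nb] := eqVneq b i => //.
- by apply: hi; lia.
- by have := lo a; lia.
by apply: ss.
Qed.

(** * Robinson-Schensted correspondence for signed words *)

Definition desc_rel (down : rel nat) (u v : bool * nat) : bool :=
  u.1 && ~~ v.1 || (u.1 == v.1) && down u.2 v.2.

(* The last letter is compared with a final 0 lying between the two alphabets.
   Words of letters use [down := gtn]; words of rows of a bitableau use
   [down := ltn]. *)
Fixpoint asc_flags (down : rel nat) (a : seq (bool * nat)) : seq bool :=
  if a is u :: a' then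
    ~~ (if a' is v :: _ then desc_rel down u v else u.1) :: asc_flags down a'
  else [::].

Lemma size_asc_flags down a : size (asc_flags down a) = size a.
Proof. by elim: a => //= u a ->. Qed.

Lemma nth_asc_flags down x0 a i : i < size a -> nth false (asc_flags down a) i =
  ~~ (if i.+1 < size a then desc_rel down (nth x0 a i) (nth x0 a i.+1) else (nth x0 a
    i).1).
Proof.
by elim: a i => [|u [|v a] IH] [|i] //= /IH ->.
Qed.

Definition part (T : Type) (b : bool) (P : T * T) : T := if b then P.1 else P.2.

(** The lattice (Yamanouchi) condition for each sign separately: every prefix describes a pair of
    partitions. *)
Definition ballot (y : seq (bool * nat)) : Prop := forall j b r,
  count_mem (b, r.+1) (take j y) <= count_mem (b, r) (take j y).

(* The last component records the sign and the row of the box created by each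
   letter: it stands for the recording bitableau. *)
Definition rsk_state : Type := seq (seq nat) * seq (seq nat) * seq (bool * nat).

Definition rsk_step (st : rsk_state) (x : bool * nat) : rsk_state :=
  let q := insert x.2 (part x.1 st.1) in
  (if x.1 then (q.2, st.1.2) else (st.1.1, q.2), rcons st.2 (x.1, q.1)).

Definition rsk : seq (bool * nat) -> rsk_state := foldl rsk_step ([::], [::], [::]).

Lemma rsk_rcons a x : rsk (rcons a x) = rsk_step (rsk a) x.
Proof. exact: foldl_rcons. Qed.

Lemma part_step st x b : part b (rsk_step st x).1 =
  if b == x.1 then (insert x.2 (part x.1 st.1)).2 else part b st.1.
Proof. by case: x => -[] x; case: b. Qed.

(** These conditions cut out exactly the image of [rsk] ([rsk_validP], [rsk_surj]). *)
Definition rsk_valid (st : rsk_state) : Prop :=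
  [/\ forall b, semistandard (part b st.1),
      forall b r, nth 0 (shape (part b st.1)) r = count_mem (b, r) st.2 &
      ballot st.2].

Lemma semistandard_size T r : semistandard T ->
  size (nth [::] T r.+1) <= size (nth [::] T r).
Proof.
elim: T r => [|s T IH] [|r] //= [_ _ [d _] tT]; last exact: IH.
by rewrite nth0.
Qed.

Lemma nth_shape (T : seq (seq nat)) r : nth 0 (shape T) r = size (nth [::] T r).
Proof. by elim: T r => [|s T IH] [|r] //=. Qed.

Lemma ballot_rcons y v : ballot (rcons y v) <->
  ballot y /\ forall b r, count_mem (b, r.+1) (rcons y v) <= count_mem (b,
    r) (rcons y v).
Proof.
split=> [h|[h1 h2] j b r].
  split=> [j b r|b r]; last by have := h (size (rcons y v)) b r; rewrite take_size.
  have [jy|yj] := leqP j (size y); first by have := h j b r; rewrite -cats1 takel_cat.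
  by have := h (size y) b r; rewrite -cats1 takel_cat // take_size take_oversize //
    ltnW.
have [jy|yj] := leqP j (size y); first by rewrite -cats1 takel_cat.
by rewrite take_oversize // size_rcons.
Qed.

Lemma count_mem_rcons (T : eqType) (s : seq T) x z :
  count_mem z (rcons s x) = count_mem z s + (x == z).
Proof. by rewrite -cats1 count_cat /= addn0. Qed.

Lemma rsk_validP a : rsk_valid (rsk a).
Proof.
elim/last_ind: a => [|a x]; first by split=> [[]|[] []|j b r].
rewrite rsk_rcons; case: (rsk a) => T y [tT sh bal].
have tT' b : semistandard (part b (rsk_step (T, y) x).1).
  by rewrite part_step; case: eqP => [_|_] //; apply: semistandard_insert.
have sh' b r : nth 0 (shape (part b (rsk_step (T, y) x).1)) r =
    count_mem (b, r) (rsk_step (T, y) x).2.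
  rewrite part_step count_mem_rcons; case: eqP => [->|/eqP ne];
    rewrite -?[count_mem _ y]sh.
    by rewrite shape_insert xpair_eqE eqxx eq_sym.
  by rewrite xpair_eqE eq_sym (negPf ne) addn0.
split=> //; apply/ballot_rcons; split=> // b r.
by rewrite -!sh' !nth_shape semistandard_size.
Qed.

Lemma size_rsk a : size (rsk a).2 = size a.
Proof. by elim/last_ind: a => // a x IH; rewrite rsk_rcons !size_rcons IH. Qed.

(** The last recorded sign and row tell which tableau changed and where its new box is, so the last
    insertion can be undone by [insert_inj]. *)
Lemma rsk_inj : injective rsk.
Proof.
move=> a a' e; have : size a = size a' by rewrite -(size_rsk a) e size_rsk.
elim/last_ind: a a' e => [|a x IH] a'; first by case: a'.
case/lastP: a' => [|a' x'] //; first by rewrite size_rcons.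
rewrite !rsk_rcons !size_rcons => e [es].
have [tT _ _] := rsk_validP a; have [tT' _ _] := rsk_validP a'.
have := e => /(congr1 snd) /rcons_inj[ey e1 er].
have := e => /(congr1 (fun st => part true st.1));
  have := e => /(congr1 (fun st => part false st.1)).
rewrite !part_step -e1 => eF eT.
have eo b : b != x.1 -> part b (rsk a).1 = part b (rsk a').1.
  by move=> ne; case: b ne eF eT => /negPf ->.
have ei : (insert x.2 (part x.1 (rsk a).1)).2 = (insert x'.2 (part x.1 (rsk a').1)).2.
  by move: eF eT; case: (x.1).
have [e2 es1] := insert_inj (tT x.1) (tT' x.1) (etrans (surjective_pairing _)
  (etrans (congr2 pair (etrans er (congr1 (fun b => (insert x'.2 (part b (rsk
    a').1)).1) (esym e1))) ei) (esym (surjective_pairing _)))).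
have -> : x = x' by rewrite (surjective_pairing x) (surjective_pairing x') e1 e2.
congr rcons; apply: IH => //.
move: eo es1 ey; case: (rsk a) (rsk a') => -[T1 T2] y [[T1' T2'] y'] /= eo es1 ->.
have eb b : part b (T1, T2) = part b (T1', T2').
  by have [->|ne] := eqVneq b x.1; [|apply: eo].
by have /= -> := eb true; have /= -> := eb false.
Qed.

Lemma rsk_surj st : rsk_valid st -> exists a, rsk a = st.
Proof.
case: st => [[T1 T2] y]; elim/last_ind: y T1 T2 => [|y [b r] IH] T1 T2 [tT sh bal].
  exists [::]; have nil U : semistandard U -> nth 0 (shape U) 0 = 0 -> U = [::].
    by case: U => // s U /= [_ + _ _] => /[swap] ->.
  have e1 := nil _ (tT true) (sh _ _); have e2 := nil _ (tT false) (sh _ _).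
  by rewrite /= in e1 e2; rewrite e1 e2.
have [bal0 _] := (ballot_rcons y (b, r)).1 bal.
(* Without its last entry the word has at least as many [r] as [r.+1]; with it row [r] is strictly
   longer than the next, so its last box is removable. *)
have corner : size (nth [::] (part b (T1, T2)) r.+1) < size (nth [::] (part b (T1,
  T2)) r).
  rewrite -!nth_shape !sh !count_mem_rcons !xpair_eqE !eqxx /=.
  have := bal0 (size y) b r; rewrite take_size => h.
  by rewrite (_ : (r == r.+1) = false) ?addn0 ?addn1 ?ltnS //; lia.
have [x [U [tU eU]]] := insert_surj (tT b) corner.
pose T0 := if b then (U, T2) else (T1, U).
have selT0 c : part c T0 = if c == b then U else part c (T1, T2).
  by rewrite /T0; case: (b) (c) => -[].
case: (IH T0.1 T0.2) => [|a]; rewrite -surjective_pairing; last move=> ea; last first.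
  exists (rcons a (b, x)); rewrite rsk_rcons ea /rsk_step /= selT0 eqxx eU /T0 /=.
  by case: (b).
split=> // [c|c q]; first by rewrite selT0; case: ifP => // _; apply: tT.
  have := sh c q; rewrite /= selT0 count_mem_rcons xpair_eqE.
  have [->|_] := eqVneq c b; last by rewrite addn0.
  by have := shape_insert x U q; rewrite eU /= => ->; rewrite [q == r]eq_sym => /addIn.
Qed.

Lemma perm_rsk a : perm_eq
  ([seq (true, i) | i <- flatten (rsk a).1.1] ++ [seq (false,
    i) | i <- flatten (rsk a).1.2]) a.
Proof.
elim/last_ind: a => [|a [b x] IH] //; rewrite rsk_rcons.
rewrite perm_sym perm_rcons perm_sym; apply/seq.permP => p; move/seq.permP/(_ p): IH.
have /(perm_map (fun i => (b, i)))/seq.permP/(_ p) := perm_insert x (part b (rsk a).1).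
by case: b; rewrite /= !count_cat; lia.
Qed.

(** Equal signs are [row_bumping], a smaller letter going to a lower row. For opposite signs, and at
    the end, the flag depends on the signs alone, which [rsk] records. *)
Lemma asc_flags_rsk a : asc_flags ltn (rsk a).2 = asc_flags gtn a.
Proof.
have sgn c : [seq x.1 | x <- (rsk c).2] = [seq x.1 | x <- c].
  by elim/last_ind: c => // c x IH; rewrite rsk_rcons !map_rcons IH.
pose x0 := (true, 0).
have adj c i : i.+1 < size c ->
    desc_rel ltn (nth x0 (rsk c).2 i) (nth x0 (rsk c).2 i.+1) = desc_rel gtn (nth x0
      c i) (nth x0 c i.+1).
  elim/last_ind: c i => // c v IH i; rewrite size_rcons ltnS => ic.
  rewrite rsk_rcons /= !nth_rcons size_rsk ic; have [ic'|] := ltnP i.+1 (size c);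
    first exact: IH.
  move=> ci; have ei : i.+1 = size c by lia.
  rewrite ei eqxx; case/lastP: c ei ic {IH ci} => [|c u] //;
    rewrite size_rcons => -[ei] _.
  rewrite rsk_rcons /= !nth_rcons size_rsk ei ltnn eqxx part_step /desc_rel /=.
  have [-> |ne] := eqVneq v.1 u.1; last by case: (u.1) (v.1) ne => -[].
  rewrite row_bumping //; have [tT _ _] := rsk_validP c; exact: tT.
apply: (@eq_from_nth _ false); rewrite !size_asc_flags ?size_rsk // => i ia.
rewrite !(nth_asc_flags _ x0) ?size_rsk //; case: ifP => [/adj -> //|_].
by rewrite -!(nth_map _ true fst) ?size_rsk // sgn.
Qed.

(** * Generating functions *)

Definition fibre (V T : choiceType) (A : set T) (wt : T -> {mset V}) m : set T :=
  (A `&` [set a | wt a = m])%classic.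

(** [genfun] counts correctly only on finite fibres, so the rules below for bijections, partitions
    and products carry this condition. *)
Definition finfib (V T : choiceType) (A : set T) (wt : T -> {mset V}) : Prop :=
  forall m, finite_set (fibre A wt m).

Lemma coef_genfun (V T : choiceType) (A : set T) (wt : T -> {mset V}) m :
  coefps (genfun A wt) m = (#|` fset_set (fibre A wt m)|%:R)%R.
Proof. by []. Qed.

Lemma coefps_sum (V I : choiceType) (R : zmodType) (r : seq I) (P : pred I)
    (F : I -> fps V R) m :
  coefps (\sum_(i <- r | P i) F i)%R m = (\sum_(i <- r | P i) coefps (F i) m)%R.
Proof. exact: (big_morph (fun f => coefps f m)). Qed.

Lemma size_fset_set (T : choiceType) (S : set T) (s : seq T) :
  uniq s -> (forall x, x \in s <-> S x) -> #|` fset_set S| = size s.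
Proof.
move=> us sS; have fS : finite_set S by apply: sub_finite_set (finite_seq s) => x /sS.
apply/perm_size/uniq_perm; rewrite ?fset_uniq //.
by move=> x; rewrite in_fset_set //; apply/idP/idP; rewrite inE => /sS.
Qed.

Lemma mem_fset_set (T : choiceType) (S : set T) : finite_set S ->
  forall x, x \in (fset_set S : seq T) <-> S x.
Proof. by move=> fS x; split; rewrite in_fset_set // inE. Qed.

Lemma card_setX (T T' : choiceType) (A : set T) (B : set T') :
  finite_set A -> finite_set B ->
  #|` fset_set (A `*` B)%classic| = #|` fset_set A| * #|` fset_set B|.
Proof.
move=> fA fB; rewrite -(size_allpairs pair); apply: size_fset_set.
  by apply: allpairs_uniq; rewrite ?fset_uniq // => -[a b] [a' b'] _ _ [-> ->].
move=> [a b]; split=> [/allpairsP[[a' b'] /= [/(mem_fset_set fA) ? /(mem_fset_set fB)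
  ? [-> ->]]] //|].
by move=> [/= /(mem_fset_set fA) Aa /(mem_fset_set fB) Bb]; apply/allpairsP;
  exists (a, b).
Qed.

Section GenfunBij.
Variables (V T T' : choiceType) (A : set T) (B : set T').
Variables (wt : T -> {mset V}) (wt' : T' -> {mset V}) (f : T -> T').
Hypothesis fA : finfib A wt.
Hypothesis fAB : forall a, A a -> B (f a).
Hypothesis f_inj : forall a a', A a -> A a' -> f a = f a' -> a = a'.
Hypothesis f_surj : forall b, B b -> exists2 a, A a & f a = b.
Hypothesis f_wt : forall a, A a -> wt' (f a) = wt a.

Lemma fibre_bij m : fibre B wt' m = (f @` fibre A wt m)%classic.
Proof.
apply/seteqP; split=> [b [/f_surj[a Aa <-]]|_ [a [Aa <-] <-]] /=.
  by rewrite f_wt // => am; exists a.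
by split; [apply: fAB|rewrite /= f_wt].
Qed.

Lemma finfib_bij : finfib B wt'.
Proof. by move=> m; rewrite fibre_bij; apply: finite_image. Qed.

Lemma genfun_bij : genfun A wt = genfun B wt'.
Proof.
apply: fpsP => m; rewrite !coef_genfun fibre_bij fset_set_image //.
rewrite card_in_imfset //= => a a'.
by rewrite !in_fset_set // !inE => -[Aa _] [Aa' _]; apply: f_inj.
Qed.

End GenfunBij.

Lemma card_partition (T I : choiceType) (S : set T) (g : T -> I) (l : seq I) :
  finite_set S -> uniq l -> (forall a, S a -> g a \in l) ->
  #|` fset_set S| = \sum_(i <- l) #|` fset_set (S `&` [set a | g a = i])%classic|.
Proof.
move=> fS ul gl; transitivity (\sum_(a <- fset_set S) \sum_(i <- l) (g a == i)).
  rewrite -[LHS]sum1_size big_seq [RHS]big_seq; apply: eq_bigr => a.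
  rewrite in_fset_set // inE => /gl gal; rewrite (bigD1_seq (g a)) //= eqxx.
  by rewrite big1 // => i; rewrite eq_sym => /negPf ->.
rewrite exchange_big; apply: eq_bigr => i _.
rewrite (@size_fset_set _ _ [seq a <- fset_set S | g a == i]).
- by rewrite size_filter -sum1_count [RHS]big_mkcond; apply: eq_bigr => a _; case: eqP.
- by rewrite filter_uniq ?fset_uniq.
move=> a; rewrite mem_filter; split=> [/andP[/eqP ga]|[Sa /= ->]].
  by rewrite in_fset_set // inE.
by rewrite eqxx in_fset_set // inE.
Qed.

Lemma genfun_partition (V T I : choiceType) (A : set T) (wt : T -> {mset V})
    (g : T -> I) (l : seq I) :
  finfib A wt -> uniq l -> (forall a, A a -> g a \in l) ->
  genfun A wt = (\sum_(i <- l) genfun (A `&` [set a | g a = i])%classic wt)%R.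
Proof.
move=> fA ul gl; apply: fpsP => m; rewrite coefps_sum coef_genfun.
rewrite (card_partition (g := g) (fA m) ul) => [|a [Aa _]]; last exact: gl.
rewrite natr_sum; apply: eq_bigr => i _; congr (#|` fset_set _|%:R)%R.
by rewrite /fibre setIAC.
Qed.

Lemma genfun0 (V T : choiceType) (wt : T -> {mset V}) : genfun set0 wt = 0%R.
Proof.
by apply: fpsP => m; rewrite coef_genfun /fibre set0I fset_set0 cardfs0.
Qed.

Section GenfunProduct.
Variables (V T T' : choiceType) (A : set T) (B : set T').
Variables (wt : T -> {mset V}) (wt' : T' -> {mset V}).
Hypotheses (fA : finfib A wt) (fB : finfib B wt').

Lemma finfibX : finfib (A `*` B)%classic (fun p => wt p.1 `+` wt' p.2)%mset.
Proof.
move=> m; pose F (p : {mset V} * {mset V}) := (fibre A wt p.1 `*` fibre B wt'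
  p.2)%classic.
apply: (@sub_finite_set _ _ (\bigcup_(p in [set` splits m]) F p)%classic).
  by move=> [a b] [[/= Aa Bb] e]; exists (wt a, wt' b) => //=; rewrite in_splits /= e.
by apply: bigcup_finite => // p _; apply: finite_setX.
Qed.

Lemma genfunM : (genfun A wt * genfun B wt')%R =
  genfun (A `*` B)%classic (fun p => wt p.1 `+` wt' p.2)%mset.
Proof.
apply: fpsP => m; rewrite coefpsM coef_genfun.
rewrite (@card_partition _ _ _ (fun p => (wt p.1, wt' p.2)) (splits m)) ?fset_uniq //.
- rewrite natr_sum !big_seq; apply: eq_bigr => -[m1 m2];
  rewrite in_splits => /eqP /= em.
  rewrite -natrM; congr (_%:R)%R; rewrite -(card_setX (fA m1) (fB m2));
    congr (#|` fset_set _|).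
  apply/seteqP; split=> -[a b] /=; last by move=> [[[Aa Bb] _] /= [e1 e2]].
  by move=> [[Aa /= e1] [Bb /= e2]]; rewrite -em -e1 -e2.
- exact: finfibX.
by move=> p [_ /= e]; rewrite in_splits e.
Qed.

End GenfunProduct.

(** A multiplicity is realised by a second component without weight: this is how the number of
    standard bitableaux becomes the recording half of a pair. *)
Lemma genfunMn (V T T' : choiceType) (A : set T) (C : set T') (wt : T -> {mset V}) :
  finfib A wt -> finite_set C ->
  (genfun A wt *+ #|` fset_set C|)%R = genfun (A `*` C)%classic (fun p => wt p.1).
Proof.
move=> fA fC; apply: fpsP => m; rewrite coef_genfun.
have -> : fibre (A `*` C)%classic (fun p => wt p.1) m = (fibre A wt m `*` C)%classic.
  by apply/seteqP; split=> -[a c] /=; [move=> [[]]|move=> [[]]].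
rewrite card_setX // natrM mulr_natr.
by elim: #|` fset_set C| => [|k IH]; rewrite ?mulr0n // !mulrS -IH.
Qed.

Notation word := (seq (bool * nat)).
Definition words_gf (A : set word) : xyseries := genfun A (fun a => seq_mset a).

Lemma finfib_word (A : set word) : finfib A (fun a => seq_mset a).
Proof.
move=> m; apply: sub_finite_set (finite_seqs (m : seq _) (size m)) => a [_ /= <-].
by rewrite (perm_size (perm_eq_seq_mset a)); split=> // v;
  rewrite (perm_mem (perm_eq_seq_mset a)).
Qed.

Lemma finfib_inj (T : choiceType) (A : set T) (f : T -> word) :
  injective f -> finfib A (fun x => seq_mset (f x)).
Proof.
move=> f_inj m; apply: (@sub_finite_set _ _ (f @^-1` fibre setT (fun a => seq_mset a)
  m)%classic).
  by move=> x [_ /= xm].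
by apply: finite_preimage (finfib_word _ _) => x y _ _; apply: f_inj.
Qed.

Lemma seq_mset_cat (V : choiceType) (s1 s2 : seq V) :
  seq_mset (s1 ++ s2) = (seq_mset s1 `+` seq_mset s2)%mset.
Proof. by apply/msetP => x; rewrite msetE2 !mset_seqE count_cat. Qed.

(** The last bit of [p] compares the last letter with the final 0, so [p] has one bit per letter. *)
Definition ribbon (p : seq bool) : xyseries := words_gf [set a | asc_flags gtn a =
  p]%classic.

Notation dsc := (desc_rel gtn).

(* e_n(x,y) *)
Definition elemL n : xyseries := words_gf [set a | sorted dsc a /\ size a = n]%classic.

Definition desc_word (s : seq nat * seq nat) : word :=
  [seq (true, i) | i <- rev s.1] ++ [seq (false, i) | i <- rev s.2].

Lemma desc_word_sorted r1 r2 : sorted gtn r1 -> sorted gtn r2 ->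
  sorted dsc ([seq (true, i) | i <- r1] ++ [seq (false, i) | i <- r2]).
Proof.
elim: r1 => [_|i r1 IH] /=; first by case: r2 => //= i r2; rewrite path_map.
case: r1 IH => [_ _|j r1 IH /= /andP[ji s1] s2]; last first.
  by have /= -> := IH s1 s2; rewrite /desc_rel /= ji.
by case: r2 => //= i' r2; rewrite path_map.
Qed.

Lemma sorted_desc_word (a : word) : sorted dsc a ->
  exists r1 r2, [/\ sorted gtn r1, sorted gtn r2 &
    a = [seq (true, i) | i <- r1] ++ [seq (false, i) | i <- r2]].
Proof.
elim: a => [_|[b i] a IH /= ba]; first by exists [::], [::].
have [r1 [r2 [s1 s2 ea]]] := IH (path_sorted ba).
case: b ba => [|] ba; first exists (i :: r1), r2; last exists [::], (i :: r2).
  split; rewrite //= ?ea //; case: r1 s1 ea => //= j r1 -> ea.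
  by move: ba; rewrite ea /= /desc_rel /= => /andP[-> _].
case: r1 s1 ea => [_ ea|j r1 _ ea]; last by rewrite ea in ba.
split; rewrite ?ea //=; case: r2 s2 ea => //= j r2 -> ea.
by move: ba; rewrite ea /= /desc_rel /= => /andP[-> _].
Qed.

Lemma finfib_elem b n :
  finfib [set s : seq nat | sorted ltn s /\ size s = n]%classic
    (fun s => seq_mset [seq ((b, i) : bool * nat) | i <- s]).
Proof. by move=> m; apply: finite_elem. Qed.

Lemma perm_seq_mset (V : choiceType) (s1 s2 : seq V) :
  perm_eq s1 s2 -> seq_mset s1 = seq_mset s2.
Proof. by move/eq_seq_msetP. Qed.

(** Positive letters exceed negative ones, so a descending word is a strictly decreasing run of
    x-letters followed by one of y-letters: a pair of finite sets. *)
Lemma elemLE n : elemL n = (\sum_(i < n.+1) elem true i * elem false (n - i))%R.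
Proof.
pose A := [set s : seq nat * seq nat |
  [/\ sorted ltn s.1, sorted ltn s.2 & size s.1 + size s.2 = n]]%classic.
pose wt (s : seq nat * seq nat) : {mset bool * nat} :=
  (seq_mset [seq (true, i) | i <- s.1] `+` seq_mset [seq (false, i) | i <- s.2])%mset.
have wtE s : seq_mset (desc_word s) = wt s.
  rewrite seq_mset_cat; congr (_ `+` _)%mset; apply: perm_seq_mset;
    by apply: perm_map; rewrite perm_rev.
have dinj : injective desc_word.
  move=> [s1 s2] [s1' s2'] e.
  have proj (b c : bool) (s : seq nat) : [seq x.2 | x <- [seq (b,
    i) | i <- s] & x.1 == c] = if b == c then s else [::].
    by elim: s => /= [|i s IH]; [case: ifP|move: IH; case: eqP => //= _ ->].
  have e1 : rev s1 = rev s1'.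
    have := congr1 (fun a => [seq x.2 | x : bool * nat <- a & x.1 == true]) e.
    by rewrite /desc_word !filter_cat !map_cat !proj /= !cats0.
  have e2 : rev s2 = rev s2'.
    have := congr1 (fun a => [seq x.2 | x : bool * nat <- a & x.1 == false]) e.
    by rewrite /desc_word !filter_cat !map_cat !proj.
  by rewrite -[s1]revK -[s2]revK e1 e2 !revK.
have fA : finfib A wt.
  by move=> m; apply: sub_finite_set (finfib_inj A dinj m) => s [As /= <-];
    split=> //; exact: wtE.
transitivity (genfun A wt).
  apply/esym; apply: (genfun_bij (f := desc_word)) => //.
  - move=> [s1 s2] [/= s1s s2s sn]; split; last by rewrite size_cat !size_map !size_rev.
    by apply: desc_word_sorted; rewrite rev_sorted.
  - by move=> s s' _ _; apply: dinj.
  move=> a [/sorted_desc_word[r1 [r2 [s1 s2 ->]]]].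
  rewrite size_cat !size_map => sn; exists (rev r1, rev r2);
    last by rewrite /desc_word !revK.
  by split; rewrite /= ?rev_sorted ?size_rev.
rewrite (@genfun_partition _ _ _ A wt (fun s => size s.1) (index_iota 0 n.+1))
  ?iota_uniq //; last first.
  by move=> [s1 s2] [_ _ sn]; rewrite mem_index_iota ltnS -sn; apply: leq_addr.
rewrite big_mkord; apply: eq_bigr => i _.
rewrite genfunM; try exact: finfib_elem.
congr genfun; apply/seteqP; split=> -[s1 s2] /=.
  by move=> [[/= s1s s2s sn] si]; do !split=> //; rewrite -si; lia.
by have := ltn_ord i => i_n [[s1s e1] [s2s e2]]; split; rewrite // /A /=; split=> //;
  lia.
Qed.

Lemma elemXE n : elem true n = ribbon (nseq n false).
Proof.
pose f (s : seq nat) : word := [seq (true, i) | i <- rev s].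
have f_inj : injective f by apply: inj_comp (can_inj revK); apply: inj_map => i j [].
apply: (genfun_bij (f := f)); first exact: finfib_elem.
- move=> s [/= ss <-] {n}; have : sorted gtn (rev s) by rewrite rev_sorted.
  rewrite /f -(size_rev s); elim: (rev s) => //= i r IH ir.
  rewrite IH ?(path_sorted ir) //; congr (_ :: _).
  by case: r ir {IH} => //= j r /andP[ji _]; rewrite /desc_rel /= ji.
- by move=> s s' _ _; apply: f_inj.
- move=> a /= pa; suff [r [sr er]] : exists r, sorted gtn r /\ a = [seq (true,
  i) | i <- r].
    exists (rev r); last by rewrite /f revK.
    split=> /=; first by rewrite rev_sorted.
    by move/(congr1 size): pa; rewrite size_asc_flags size_nseq er size_map size_rev.
  elim: a n pa => [|u a IH] n; first by exists [::].
  case: n => //= n [+ /IH[r [sr ea]]]; rewrite {a IH}ea.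
  case: u => b i; case: r sr => [|j r] sr /=.
    by case: b => // _; exists [:: i].
  by rewrite /desc_rel; case: b => //= /negbFE ji; exists [:: i, j & r]; rewrite /= ji.
by move=> s _; apply: perm_seq_mset; apply: perm_map; rewrite perm_rev.
Qed.

(** The free bit [x] compares the last letter of [a] with the first of [b], or with the final 0 when
    [b] is empty. *)
Lemma asc_flags_cat (a b : word) m p : size a = m.+1 ->
  (sorted dsc a /\ asc_flags gtn b = p) <-> exists x,
    asc_flags gtn (a ++ b) = nseq m false ++ x :: p.
Proof.
elim: a m => [|u a IH] // m [<-] {m}; case: a IH => [_|v a IH] /=.
  by split=> [[_ ->]|[x [_ ->]]] //; eexists.
split=> [[/andP[uv sa] pb]|[x [/negbFE uv e]]].
  have [//|x] := (IH (size a) erefl).1; exists x.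
  by rewrite uv; congr (_ :: _).
by have [sa pb] := (IH (size a) erefl).2 (ex_intro _ x e); rewrite uv.
Qed.

Lemma elemL_ribbon m p : (elemL m.+1 * ribbon p)%R =
  (ribbon (nseq m false ++ false :: p) + ribbon (nseq m false ++ true :: p))%R.
Proof.
rewrite genfunM; try exact: finfib_word.
pose C := [set c : word | exists x, asc_flags gtn c = nseq m false ++ x :: p]%classic.
transitivity (words_gf C).
  apply: (genfun_bij (f := fun ab : word * word => ab.1 ++ ab.2)).
  - by apply: finfibX; apply: finfib_word.
  - by move=> [a b] [[/= sa za] pb]; apply/asc_flags_cat.
  - move=> [a b] [a' b'] [[/= _ za] _] [[/= _ za'] _] /= /eqP.
    by rewrite eqseq_cat ?za ?za' // => /andP[/eqP -> /eqP ->].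
  - move=> c Cc; have zc : m.+1 <= size c.
      by case: Cc => x /(congr1 size); rewrite size_asc_flags size_cat size_nseq /=;
        lia.
    have zt : size (take m.+1 c) = m.+1 by rewrite size_take_min; lia.
    exists (take m.+1 c, drop m.+1 c); last by rewrite /= cat_take_drop.
    rewrite -[c](cat_take_drop m.+1) in Cc.
    by have [] := (asc_flags_cat (drop m.+1 c) p zt).2 Cc.
  by move=> [a b] _; rewrite /= seq_mset_cat.
pose g (c : word) := nth false (asc_flags gtn c) m.
have nthg x : nth false (nseq m false ++ x :: p) m = x.
  by rewrite nth_cat size_nseq ltnn subnn.
rewrite /words_gf (@genfun_partition _ _ _ C _ g [:: false; true]) //; last 2 first.
- exact: finfib_word.
- by move=> c _; rewrite !inE; case: (g c).
rewrite !big_cons big_nil addr0 /ribbon /words_gf; congr (_ + _)%R; congr genfun;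
  apply/seteqP; split=> c /=; rewrite /g.
- by move=> [[x ->]]; rewrite nthg => ->.
- by move=> e; rewrite e nthg; split=> //; exists false.
- by move=> [[x ->]]; rewrite nthg => ->.
by move=> e; rewrite e nthg; split=> //; exists true.
Qed.

(** * Standard bitableaux as ballot words *)

Definition flag_set n (p : seq bool) : {set 'I_n} := [set i : 'I_n | nth false p i]%SET.

(** Serves both bitableaux, with [a] the word of rows, and inverse signed permutations, with [a] the
    word of letters. The extra element n of Des_B is the descent to the final 0. *)
Lemma ascB_desc n (a : seq (bool * nat)) (down : rel nat) (x0 : bool * nat)
    (eps : {ffun 'I_n -> bool}) (downI : rel 'I_n) :
  size a = n -> (forall i, eps i = (nth x0 a i).1) ->
  (forall i j, downI i j = down (nth x0 a i).2 (nth x0 a j).2) ->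
  ascB (desc eps downI, eps) = flag_set n (asc_flags down a).
Proof.
move=> sa epsE downE; apply/setP => i; rewrite !inE (nth_asc_flags _ x0) ?sa //.
congr (~~ _); rewrite epsE /desc_rel; have [i1|] := ltnP i.+1 n.
  rewrite (_ : (i.+1 == n) = false) ?orbF; last by lia.
  apply/existsP/idP => [[j /andP[/eqP ej]]|h]; first by rewrite !epsE downE ej.
  by exists (Ordinal i1); rewrite eqxx /= !epsE downE.
move=> ni; rewrite (_ : i.+1 == n); last by have := ltn_ord i; lia.
rewrite orbC; case: (nth _ _ _).1 => //=; apply/existsP => -[j /andP[/eqP ej _]].
by have := ltn_ord j; lia.
Qed.

Lemma semistandardE (T : seq (seq nat)) :
  semistandard T <-> is_part (shape T) /\ tableau leq (shape T) T.
Proof.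
rewrite /is_part; elim: T => [|s T IH] /=; first by split=> // _; split.
rewrite inE negb_or; split.
  move=> [ss s0 [dz d] tT]; have [/andP[sT nT] [_ aT cT]] := IH.1 tT; split.
    by move: dz sT; rewrite eq_sym -lt0n s0 nT !andbT; case: (T) => //= t T' -> ->.
  split=> //=; first by rewrite ss.
  by move=> [|r] c; [rewrite nth0; apply: d|apply: cT].
move=> [/andP[sT /andP[s0 nT]] [_ /= /andP[ss aT] cT]]; split=> //.
- by rewrite lt0n eq_sym.
- split; first by case: T sT {IH nT aT cT} => //= t T /andP[].
  by move=> c; rewrite -nth0; apply: (cT 0).
- apply/IH; split; first by rewrite nT (path_sorted sT).
  by split=> // r c; apply: (cT r.+1).
Qed.

Lemma count_gtn_sorted s j c : sorted ltn s -> c < size s ->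
  (nth 0 s c < j) = (c < count (gtn j) s).
Proof.
elim: s c => // x s IH c /= xs; have ss := path_sorted xs.
have [xj|jx] := ltnP x j.
  by case: c => [|c]; rewrite ?xj // ltnS => /IH ->.
have /all_nthP sx := order_path_min ltn_trans xs.
have -> : count (gtn j) s = 0.
  apply/eqP; rewrite -leqn0 leqNgt -has_count; apply/(has_nthP 0) => -[k ks /=].
  by have := sx 0 k ks; rewrite /=; lia.
case: c => [|c] /=; first by lia.
by rewrite ltnS => cs; have := sx 0 c cs; rewrite /=; lia.
Qed.

(** Reformulates column strictness as a condition on initial segments, which is the ballot condition
    when the rows are the sets of positions of two letters. *)
Lemma column_strict_count s1 s2 : sorted ltn s1 -> sorted ltn s2 ->
  (forall i, i \in s1 -> i \notin s2) ->
  column_strict s1 s2 <-> forall j, count (gtn j) s2 <= count (gtn j) s1.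
Proof.
move=> ss1 ss2 dis; split=> [[sz d] j|h].
  have [->//|k0] := posnP (count (gtn j) s2).
  have k2 := count_size (gtn j) s2;
    have e1 := @count_gtn_sorted s1 j (count (gtn j) s2).-1 ss1.
  have e2 := @count_gtn_sorted s2 j (count (gtn j) s2).-1 ss2.
  have := d (count (gtn j) s2).-1; lia.
have sz : size s2 <= size s1.
  have := h (\max_(x <- s2) x).+1;
    have -> : count (gtn (\max_(x <- s2) x).+1) s2 = size s2.
    by apply/eqP; rewrite -all_count; apply/allP => x xs /=; rewrite ltnS;
      apply: leq_bigmax_seq.
  by move=> /leq_trans; apply; apply: count_size.
split=> // c cs; rewrite ltn_neqAle; apply/andP; split.
  have c1 : c < size s1 by lia.
  by apply/eqP => e; have := dis _ (mem_nth 0 c1); rewrite e mem_nth.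
(* Equality is excluded by disjointness. Taking [j] one above entry [c] of [s2], more than [c]
   entries of [s2], hence of [s1], lie below [j]. *)
rewrite -ltnS count_gtn_sorted //; last by lia.
by apply: leq_trans (h _); rewrite -count_gtn_sorted.
Qed.

(** Row [v.2] of the recording tableau of sign [v.1]. *)
Definition word_row (y : seq (bool * nat)) (v : bool * nat) : seq nat :=
  [seq i <- iota 0 (size y) | nth (true, 0) y i == v].

Lemma mem_word_row y v i : (i \in word_row y v) = (i < size y) && (nth (true,
  0) y i == v).
Proof. by rewrite mem_filter mem_iota add0n andbC. Qed.

Lemma sorted_word_row y v : sorted ltn (word_row y v).
Proof. by apply: sorted_filter; [apply: ltn_trans|apply: iota_ltn_sorted]. Qed.

Lemma count_take_word_row y v j : count_mem v (take j y) = count (gtn j) (word_row y v).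
Proof.
have -> : take j y = take (minn j (size y)) y by rewrite /minn; case: ltnP => // h;
  rewrite take_size take_oversize.
rewrite -(map_nth_iota0 (true, 0)) ?geq_minr // count_map /word_row count_filter.
rewrite -{2}(subnKC (geq_minr j (size y))) iotaD count_cat [X in _ + X](_ : _ = 0);
  last first.
  apply/eqP; rewrite -leqn0 leqNgt -has_count; apply/hasPn => i; rewrite mem_iota /=;
    lia.
rewrite addn0; apply: eq_in_count => i; rewrite mem_iota /=; lia.
Qed.

Lemma size_word_row y v : size (word_row y v) = count_mem v y.
Proof.
rewrite -[y in RHS]take_size count_take_word_row; apply/esym/eqP; rewrite -all_count.
by apply/allP => i; rewrite mem_word_row => /andP[].
Qed.

Lemma ballot_column_strict y : ballot y <-> forall b r, column_strict (word_row y (b,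
  r)) (word_row y (b, r.+1)).
Proof.
have dis b r i : i \in word_row y (b, r) -> i \notin word_row y (b, r.+1).
  by rewrite !mem_word_row => /andP[-> /eqP ->] /=; rewrite xpair_eqE; lia.
have domE b r := column_strict_count (sorted_word_row y (b,
  r)) (sorted_word_row y (b, r.+1)) (dis b r).
split=> [h b r|h j b r]; first by apply/domE => // j; rewrite -!count_take_word_row;
  apply: h.
by rewrite !count_take_word_row; exact: (domE b r).1 (h b r) j.
Qed.

Definition row_word n (P : bitableau) : seq (bool * nat) :=
  [seq let b := i \in flatten P.1 in
       (b, find (fun s => i \in s) (part b P)) | i <- iota 0 n].

Definition bitab_of_word (p : seq nat * seq nat) (y : seq (bool * nat)) : bitableau :=
  ([seq word_row y (true, r) | r <- iota 0 (size p.1)],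
   [seq word_row y (false, r) | r <- iota 0 (size p.2)]).

Lemma size_row_word n P : size (row_word n P) = n.
Proof. by rewrite size_map size_iota. Qed.

Lemma nth_row_word n P i : i < n -> nth (true, 0) (row_word n P) i =
  (i \in flatten P.1, find (fun s => i \in s) (part (i \in flatten P.1) P)).
Proof. by move=> i_n; rewrite (nth_map 0) ?size_iota // nth_iota. Qed.

Lemma mem_flatten_nth (T : seq (seq nat)) i r : i \in nth [::] T r -> i \in flatten T.
Proof.
have [rT|rT] := ltnP r (size T); last by rewrite nth_default.
by move=> ir; apply/flattenP; exists (nth [::] T r) => //; apply: mem_nth.
Qed.

Lemma uniq_flatten_nth (T : seq (seq nat)) i r : uniq (flatten T) ->
  i \in nth [::] T r -> find (fun s => i \in s) T = r.
Proof.
elim: T r => [|s T IH] [|r] //=; rewrite ?nth_nil ?cat_uniq => //.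
  by move=> _ ->.
move=> /and3P[_ /hasPn dis uT] ir; rewrite (IH r) //.
by rewrite (negPf (dis _ (mem_flatten_nth ir))).
Qed.

Section SYT.
Variables (n : nat) (p : seq nat * seq nat).
Hypotheses (p1 : is_part p.1) (p2 : is_part p.2).

Lemma SYT_row P b r : SYT n p P ->
  nth [::] (part b P) r = word_row (row_word n P) (b, r).
Proof.
move=> [tP1 tP2 PQ]; have uPQ : uniq (flatten P.1 ++ flatten P.2).
  by rewrite (perm_uniq PQ) iota_uniq.
have /and3P[u1 /hasPn dis u2] : [&& uniq (flatten P.1),
  ~~ has [in flatten P.1] (flatten P.2) & uniq (flatten P.2)] by rewrite -cat_uniq.
have memPQ i : (i \in flatten P.1 ++ flatten P.2) = (i < n) by rewrite (perm_mem PQ)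
  mem_iota.
apply: (irr_sorted_eq ltn_trans ltnn); last move=> i.
- have [rs|rs] := ltnP r (size (part b P)); last by rewrite nth_default.
  by apply: (allP _ _ (mem_nth [::] rs)); case: (b); [case: tP1|case: tP2].
- exact: sorted_word_row.
rewrite mem_word_row size_row_word; apply/idP/andP => [ir|[i_n]].
  have i_b := mem_flatten_nth ir.
  have i_n : i < n by rewrite -memPQ mem_cat; case: (b) i_b => /= ->; rewrite ?orbT.
  split=> //; rewrite nth_row_word //.
  have -> : (i \in flatten P.1) = b.
    by case: (b) i_b => //= /dis/negPf.
  by rewrite (uniq_flatten_nth _ ir) ?eqxx //; case: (b).
rewrite nth_row_word // xpair_eqE => /andP[/eqP eb]; rewrite eb => /eqP <-.
apply: (@nth_find _ [::] (fun s => i \in s)); apply/hasP.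
have /flattenP[s sP si] : i \in flatten (part b P); last by exists s.
by move: eb; rewrite -memPQ mem_cat in i_n; case: (b) => //= /negbT/negPf e;
  rewrite e in i_n.
Qed.

Lemma SYT_bitab_of_word P : SYT n p P -> bitab_of_word p (row_word n P) = P.
Proof.
rewrite /bitab_of_word => PP; have rowE b r := SYT_row b r PP;
  case: PP => -[<- _ _] [<- _ _] _.
rewrite [RHS]surjective_pairing; congr pair; rewrite size_map;
  apply: (@eq_from_nth _ [::]); rewrite size_map size_iota // => r rs;
  by rewrite (nth_map 0) ?size_iota // nth_iota // -rowE.
Qed.

Lemma SYT_count P b r : SYT n p P ->
  count_mem (b, r) (row_word n P) = nth 0 (part b p) r.
Proof.
move=> PP; rewrite -size_word_row -SYT_row // -nth_shape;
  case: PP => -[e1 _ _] [e2 _ _] _.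
by case: (b); rewrite /= ?e1 ?e2.
Qed.

Lemma part_nth l r : is_part l -> nth 0 l r.+1 <= nth 0 l r.
Proof.
move=> /andP[sl _]; have [rl|rl] := ltnP r.+1 (size l); last by rewrite nth_default.
by move/(sortedP 0): sl => /(_ r rl).
Qed.

Lemma SYT_ballot P : SYT n p P -> ballot (row_word n P).
Proof.
move=> PP; apply/ballot_column_strict => b r; rewrite -!SYT_row //.
case: PP => -[e1 _ c1] [e2 _ c2] _; split; last by move=> c; case: (b);
  [apply: c1|apply: c2].
by rewrite -!nth_shape; case: (b); rewrite /= ?e1 ?e2; apply: part_nth.
Qed.

Lemma nth_bitab_of_word y b r : (forall b r, count_mem (b, r) y = nth 0 (part b p) r) ->
  nth [::] (part b (bitab_of_word p y)) r = word_row y (b, r).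
Proof.
move=> cy; have -> : part b (bitab_of_word p y) = [seq word_row y (b,
  r) | r <- iota 0 (size (part b p))].
  by case: (b).
have [rs|rs] := ltnP r (size (part b p)).
  by rewrite (nth_map 0) ?size_iota // nth_iota.
rewrite nth_default ?size_map ?size_iota //; apply/esym/size0nil.
by rewrite size_word_row cy nth_default.
Qed.

Lemma bitab_of_word_SYT y : (sumn p.1 + sumn p.2)%N = n -> size y = n -> ballot y ->
  (forall b r, count_mem (b, r) y = nth 0 (part b p) r) -> SYT n p (bitab_of_word p y).
Proof.
move=> pn yn bal cy.
have shT b : shape (part b (bitab_of_word p y)) = part b p.
  apply: (@eq_from_nth _ 0) => [|r _]; first by case: (b);
    rewrite /= !size_map size_iota.
  by rewrite nth_shape nth_bitab_of_word // size_word_row cy.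
have tT b : tableau ltn (part b p) (part b (bitab_of_word p y)).
  split=> // [|r c]; last by rewrite !nth_bitab_of_word // => cr;
    apply: ((ballot_column_strict y).1 bal b r).2.
  by case: (b); apply/allP => s /mapP[r _ ->]; apply: sorted_word_row.
split; [exact: (tT true)|exact: (tT false)|].
(* Every entry occurs and the shapes offer exactly [n] boxes, so none occurs twice. *)
have sub : {subset iota 0 n <= flatten (bitab_of_word p y).1 ++ flatten
  (bitab_of_word p y).2}.
  move=> i; rewrite mem_iota add0n => /= i_n.
  case e: (nth (true, 0) y i) => [b r].
  have : i \in flatten (part b (bitab_of_word p y)).
    by apply: (@mem_flatten_nth _ _ r);
      rewrite nth_bitab_of_word // mem_word_row yn i_n e eqxx.
  by rewrite mem_cat; case: (b) => /= ->; rewrite ?orbT.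
have sz : size (flatten (bitab_of_word p y).1 ++ flatten (bitab_of_word p y).2) <=
  size (iota 0 n).
  rewrite size_cat size_iota !size_flatten.
  by have /= -> := shT true; have /= -> := shT false; rewrite pn.

have [_ mem] := uniq_min_size (iota_uniq 0 n) sub sz.
by apply: uniq_perm; rewrite ?iota_uniq // (leq_size_uniq (iota_uniq 0 n) sub sz).
Qed.

Lemma bitab_of_wordK y : size y = n -> SYT n p (bitab_of_word p y) ->
  (forall b r, count_mem (b, r) y = nth 0 (part b p) r) ->
    row_word n (bitab_of_word p y) = y.
Proof.
move=> yn PP cy; apply: (@eq_from_nth _ (true, 0)); rewrite size_row_word // => i i_n.
case e: (nth (true, 0) y i) => [b r].
have : i \in word_row y (b, r) by rewrite mem_word_row yn i_n e eqxx.
by rewrite -nth_bitab_of_word // SYT_row // mem_word_row => /andP[_ /eqP].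
Qed.

End SYT.

Lemma ascB_SYT n (P : bitableau) : ascB (sDes_tab n P) = flag_set n (asc_flags ltn
  (row_word n P)).
Proof.
apply: (ascB_desc (x0 := (true, 0))) => [|i|i j]; first exact: size_row_word.
  by rewrite ffunE nth_row_word.
by rewrite !nth_row_word // !ffunE.
Qed.

(** * Gamma expansion *)

(* At the start [prev := true] forbids an ascent in position 1. *)
Fixpoint stab_flags (prev : bool) (q : seq bool) : bool :=
  if q is x :: q' then ~~ (prev && x) && stab_flags x q' else true.

Fixpoint bitseqs n : seq (seq bool) :=
  if n is n'.+1 then map (cons false) (bitseqs n') ++ map (cons true) (bitseqs n')
    else [:: [::]].

Lemma mem_bitseqs n q : (q \in bitseqs n) = (size q == n).
Proof.
elim: n q => [|n IH] [|b q]; rewrite ?inE // mem_cat.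
  by apply/norP; split; apply/mapP => -[].
rewrite eqSS -IH; apply/orP/idP => [[|] /mapP[q' qb [_ ->]] //|qb].
by case: b; [right|left]; apply: map_f.
Qed.

Lemma bitseqs_uniq n : uniq (bitseqs n).
Proof.
have inj (b : bool) : injective (cons b) by move=> x y [].
elim: n => //= n IH; rewrite cat_uniq !(map_inj_uniq (@inj _)) IH /= andbT.
by apply/hasPn => q /mapP[q' _ ->]; apply/mapP => -[].
Qed.

(** Each ascent is paired with the descent just before it, and a final descent is left over;
    [~~ prev] provides the partner of an ascent in first position. *)
Lemma stab_flags_count prev q :
  stab_flags prev q -> 2 * count id q + ~~ last prev q <= size q + ~~ prev.
Proof.
elim: q prev => [|x q IH] prev //=.
by move=> /andP[+ /IH]; case: prev x => -[] //= _; lia.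
Qed.

Lemma stab_flags_cat j q : stab_flags true (nseq j false ++ true :: q) = (0 < j) &&
  stab_flags true q.
Proof.
case: j => //= j; have: stab_flags false (nseq j false ++ true :: q) = stab_flags
  true q.
  by elim: j => //= j ->.
by move=> ->.
Qed.

Section Weight.
Variables (R : comNzRingType) (t : R).
Local Open Scope ring_scope.

(* The truncated subtraction is exact by [stab_flags_count]. *)
Definition weight (top : bool) (q : seq bool) : R :=
  if stab_flags true q && (last true q == top) then
    t ^+ count id q * (1 + t) ^+ (size q - ~~ top - 2 * count id q)
  else 0.

(* A run of length m ending with an ascent contributes [run_weight m]; the value
   1 at m = 0 makes [run_weight_sum] hold. *)
Definition run_weight (m : nat) : R :=
  if m is m'.+1 then if m' is m''.+1 then t * (1 + t) ^+ m'' else 0 else 1.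

Lemma weight_cat top j q :
  weight top (nseq j false ++ true :: q) = run_weight j.+1 * weight top q.
Proof.
rewrite /weight stab_flags_cat last_cat /=; case: j => [|j]; first by rewrite mul0r.
case: ifP => [/andP[sq lq]|_]; last by rewrite mulr0.
rewrite count_cat count_nseq mul0n size_cat size_nseq /= add0n exprS.
have := stab_flags_count sq; rewrite (eqP lq) => h.
have -> : (j.+1 + (size q).+1 - ~~ top - 2 * (true + count id q) =
  j + (size q - ~~ top - 2 * count id q))%N by lia.
by rewrite exprD; ring.
Qed.

(** The default of [last true] lets the empty pattern end with an ascent, in agreement with
    xi^+_{0,0} = 1 and with the absence of a term n = 0 for xi^-. *)
Lemma weight_nseq top n : weight top (nseq n false) =
  if top then (n == 0)%:R else if n is n'.+1 then (1 + t) ^+ n' else 0.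
Proof.
have cn : count id (nseq n false) = 0%N by rewrite count_nseq mul0n.
have sn : stab_flags true (nseq n false) by case: n {cn} => //=; elim.
have ln : last true (nseq n false) = (n == 0)%N by case: n {cn sn} => //=; elim.
rewrite /weight sn ln cn size_nseq /= expr0 mul1r muln0 subn0; case: top;
  case: n {cn sn ln} => //= n.
by rewrite subSS subn0.
Qed.

(** The effect of a last run without ascent: sum_m (t^m - t) z^m times z/(1-(1+t)z) equals 1/(1-z) -
    1/(1-tz). *)
Lemma geometric_sum n :
  \sum_(m < n) (t ^+ m - t) * (1 + t) ^+ (n - m.+1) = 1 - t ^+ n.
Proof.
elim: n => [|n IH]; first by rewrite big_ord0 expr0 subrr.
rewrite big_ord_recr /= subnn expr0 mulr1.
rewrite (eq_bigr (fun m : 'I_n => (1 + t) * ((t ^+ m - t) * (1 + t) ^+ (n - m.+1)))).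
  by rewrite -mulr_sumr IH exprS; ring.
by move=> m _; rewrite subSn // exprS; ring.
Qed.

(** The terms m < r add up to t (1 - t^r) by [geometric_sum], the term m = r vanishes since u(1) =
    0, and m = r + 1 gives t^(r+1) - t since u(0) = 1. *)
Lemma run_weight_sum r :
  \sum_(m < r.+2) (t ^+ m - t) * run_weight (r.+1 - m) = 0.
Proof.
rewrite !big_ord_recr /= subnn subSnn /= mulr0 addr0 mulr1.
rewrite (eq_bigr (fun m : 'I_r => t * ((t ^+ m - t) * (1 + t) ^+ (r - m.+1)))).
  by rewrite -mulr_sumr geometric_sum exprS; ring.
move=> m _; have -> : (r.+1 - m = (r - m.+1).+2)%N by have := ltn_ord m; lia.
by rewrite /=; ring.
Qed.

Lemma all_take_nseq j m q : (m <= j)%N -> all negb (take m (nseq j false ++ q)).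
Proof.
move=> mj; rewrite takel_cat ?size_nseq //; apply/allP => x /mem_take.
by rewrite mem_nseq => /andP[_ /eqP ->].
Qed.

(** The left side is the coefficient of [ribbon q] after multiplication by the denominator: [q]
    arises by cutting off [m] letters exactly when its first [m.-1] bits are descents. If [q] has an
    ascent, the weight of what follows the first one factors out. *)
Lemma weight_sum top n q : size q = n ->
  \sum_(m < n.+1 | all negb (take m.-1 q)) (t ^+ m - t) * weight top (drop m q) =
  (q == nseq n false)%:R * if top then t ^+ n - t else 1 - t ^+ n.
Proof.
move=> <- {n}; have [-> |ne] := eqVneq q (nseq (size q) false).
  rewrite size_nseq mul1r; move: (size q) => n {q}.
  rewrite (eq_bigl xpredT); last first.
    move=> m; rewrite -[nseq n false]cats0 all_take_nseq //.
    by have := ltn_ord m; lia.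
  rewrite (eq_bigr (fun m : 'I_n.+1 => (t ^+ m - t) * weight top (nseq (n - m)
    false))); last first.
    by move=> m _; rewrite drop_nseq.
  rewrite big_ord_recr /= subnn !weight_nseq; case: top.
    rewrite mulr1 big1 ?add0r // => m _; rewrite weight_nseq.
    by rewrite (_ : (_ == _) = false) ?mulr0 //; have := ltn_ord m; lia.
  rewrite mulr0 addr0 -geometric_sum; apply: eq_bigr => m _; rewrite weight_nseq.
  by rewrite (_ : (n - m = (n - m.+1).+1)%N) //; have := ltn_ord m; lia.
rewrite mul0r.
have [r [p e]] : exists r p, q = nseq r false ++ true :: p.
  elim: q ne => [|[] q IH] //=; first by exists 0%N, q.
  by rewrite eqseq_cons /= => /IH[r [p ->]]; exists r.+1, p.
have sq : size q = (r.+1 + size p)%N by rewrite e size_cat size_nseq /=; lia.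
rewrite sq -(big_mkord (fun m => all negb (take m.-1 q)) (fun m => (t ^+ m - t) *
  weight top (drop m q))).
(* From [m = r.+2] on, the first [m.-1] bits include the ascent at index [r]. The bit at the cut is
   free, so [m = r.+1] is still allowed. *)
rewrite (@big_cat_nat _ _ _ r.+2) //=; last by lia.
rewrite [X in _ + X]big1_seq ?addr0; last first.
  move=> m /andP[+ ]; rewrite mem_index_iota => /allP h /andP[mr _].
  have := h true; rewrite e take_cat size_nseq ifF; last by lia.
  rewrite mem_cat (_ : m.-1 - r = (m.-1 - r.+1).+1)%N /= ?inE ?eqxx ?orbT; last by lia.
  by move=> /(_ isT).
rewrite big_mkord.
transitivity (\sum_(m < r.+2) (t ^+ m - t) * run_weight (r.+1 - m) * weight top p);
  last first.
  by rewrite -mulr_suml run_weight_sum mul0r.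
apply: eq_big => [m|m _].
  by rewrite e all_take_nseq //; have := ltn_ord m; lia.
rewrite -mulrA; congr (_ * _); rewrite e drop_cat size_nseq; case: ltnP => mr.
  by rewrite drop_nseq weight_cat subSn // ltnW.
(* At [m = r] the rest starts with an ascent, of run weight 0; at [m = r.+1] the whole run is cut
   off, of run weight 1. *)
have [->|m_r] : m = r :> nat \/ m = r.+1 :> nat by have := ltn_ord m; lia.
  by rewrite subnn drop0 -[true :: p]/(nseq 0 false ++ true :: p) weight_cat subSnn.
by rewrite m_r subSnn subnn mul1r /= drop0.
Qed.

End Weight.

Lemma big_bitseqs_cat (R : zmodType) m k (H : seq bool -> R) :
  (\sum_(q <- bitseqs (m.+1 + k) | all negb (take m q)) H q =
   \sum_(p <- bitseqs k) (H (nseq m false ++ false :: p) + H (nseq m false ++ true ::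
     p)))%R.
Proof.
elim: m H => [|m IH] H; rewrite [bitseqs _]/= big_cat !big_map /=.
  by rewrite -big_split.
rewrite [X in (_ + X)%R]big_pred0 // addr0.
exact: (IH (fun q => H (false :: q))).
Qed.

Lemma elemL_sum m n (F : seq bool -> {poly xyseries}) : m <= n ->
  ((elemL m)%:P * \sum_(p <- bitseqs (n - m)) F p * (ribbon p)%:P =
   \sum_(q <- bitseqs n | all negb (take m.-1 q)) F (drop m q) * (ribbon q)%:P)%R.
Proof.
case: m => [_|m mn].
  rewrite subn0 elemLE big_ord1 !elem0 mulr1 mul1r.
  by apply: eq_big => q; rewrite ?take0 // drop0.
rewrite -{2}(subnKC mn) big_bitseqs_cat mulr_sumr; apply: eq_bigr => p _.
rewrite mulrCA -polyCM elemL_ribbon polyCD mulrDr.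
have dE x : drop m.+1 (nseq m false ++ x :: p) = p.
  by rewrite drop_cat size_nseq ltnNge leqnSn /= subSnn /= drop0.
by rewrite !dE.
Qed.

(** The coefficient of z^n in the expansion, with patterns not yet grouped by number of ascents. *)
Definition gamma_sum top n : {poly xyseries} :=
  (\sum_(q <- bitseqs n) weight 'X top q * (ribbon q)%:P)%R.

Lemma gamma_sum_rec top n :
  (\sum_(m < n.+1) ((elemL m)%:P * ('X ^+ m - 'X)) * gamma_sum top (n - m) =
   (elem true n)%:P * if top then 'X ^+ n - 'X else 1 - 'X ^+ n)%R.
Proof.
transitivity (\sum_(m < n.+1) \sum_(q <- bitseqs n | all negb (take m.-1 q))
   (('X ^+ m - 'X) * weight 'X top (drop m q)) * (ribbon q)%:P)%R.
  apply: eq_bigr => m _; rewrite mulrAC elemL_sum; last by have := ltn_ord m; lia.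
  by rewrite mulr_suml; apply: eq_bigr => q _; ring.
rewrite (exchange_big_dep xpredT) //= (eq_big_seq (fun q =>
   (ribbon q)%:P * ((q == nseq n false)%:R * if top then 'X ^+ n - 'X else 1 - 'X ^+
     n)))%R; last first.
  move=> q; rewrite mem_bitseqs => /eqP qn.
  by rewrite -mulr_suml weight_sum // mulrC.
rewrite (bigD1_seq (nseq n false)) ?bitseqs_uniq ?mem_bitseqs ?size_nseq //= eqxx mul1r.
by rewrite -elemXE big1 ?addr0 // => q /negPf ->; rewrite mul0r mulr0.
Qed.

Lemma card_flag_set n q : size q = n -> #|flag_set n q| = count id q.
Proof.
move=> sq; rewrite -sum1_card -sum1_count (big_nth false) sq big_mkord.
by apply: eq_bigl => i; rewrite inE.
Qed.

Lemma stab_flagsP (prev : bool) q : reflect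
  ((prev -> ~~ nth false q 0) /\ forall i, nth false q i -> ~~ nth false q i.+1)
  (stab_flags prev q).
Proof.
elim: q prev => [|x q IH] prev /=.
  by apply: ReflectT; split=> [|i]; rewrite ?nth_nil.
apply: (iffP andP) => [[px /IH[h0 h]]|[h0 h]].
  by split=> [|[|i]] //=; [case: prev px|apply: h].
split; first by case: prev h0 => // ->.
by apply/IH; split=> [|i]; [apply: (h 0)|apply: (h i.+1)].
Qed.

Lemma stab_kE n k top q : 0 < n -> size q = n ->
  stab_k top k (flag_set n q) = [&& stab_flags true q,
    count id q == k & last true q == top].
Proof.
move=> n0 sq; rewrite /stab_k card_flag_set //; congr [&& _, _ & _]; last first.
  congr (_ == top); have n1 : n.-1 < n by lia.
  have -> : last true q = nth false q n.-1.
    by rewrite -sq nth_last; case: (q) sq => [e|//]; rewrite -e in n0.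
  apply/existsP/idP => [[i /andP[]]|h].
    by rewrite inE => h /eqP <-.
  by exists (Ordinal n1); rewrite inE /= h /=; lia.
rewrite inE; apply/andP/stab_flagsP => [[/fintype.subsetP h0 /forallP h]|[h0 h]].
  split=> [_|i qi]; first by apply/negP => q0; have := h0 (Ordinal n0);
    rewrite !inE /= q0 => /(_ isT).
  apply/negP => qi1; have i1 : i.+1 < n.
    by rewrite ltnNge; apply/negP => ni; rewrite nth_default // sq in qi1.
  have := h (Ordinal (ltnW i1)); rewrite inE /= qi /= => /forallP/(_ (Ordinal i1)).
  by rewrite inE /= qi1 /= eqxx.
split; first by apply/fintype.subsetP => i; rewrite !inE lt0n;
  apply: contraL => /eqP ->; apply: h0.
apply/forallP => i; apply/implyP; rewrite inE => qi; apply/forallP => j; apply/implyP.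
by rewrite inE => qj; apply/negP => /eqP e; have := h i qi; rewrite -e qj.
Qed.

(** * Words with stable ascent set and pairs of bitableaux *)

Definition stab_words top k n : set (seq (bool * nat)) :=
  [set a | size a = n /\ stab_k top k (flag_set n (asc_flags gtn a))]%classic.

Lemma stab_words_ribbon top k n : words_gf (stab_words top k n) =
  (\sum_(q <- bitseqs n | stab_k top k (flag_set n q)) ribbon q)%R.
Proof.
rewrite /words_gf (genfun_partition (g := asc_flags gtn) (l := bitseqs n))
  ?bitseqs_uniq //.
- rewrite [RHS]big_mkcond !big_seq; apply: eq_bigr => q; rewrite mem_bitseqs => /eqP qn.
  case: ifP => [sq|/negP nsq].
    congr genfun; apply/seteqP; split=> a /=; first by case.
    by move=> e; split=> //; split; rewrite ?e // -qn -e size_asc_flags.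
  rewrite -[RHS](genfun0 (fun a : seq (bool * nat) => seq_mset a)); congr genfun.
  by apply/seteqP; split=> a //= [[_ +] e]; rewrite e.
- exact: finfib_word.
by move=> a [an _]; rewrite mem_bitseqs size_asc_flags an.
Qed.

Definition bishape (z : bitableau) : seq nat * seq nat := (shape z.1, shape z.2).

Definition tableau_pairs top k n : set (bitableau * bitableau) :=
  [set z | [/\ bipart n (bishape z.1),
     tableau leq (shape z.1.1) z.1.1 /\ tableau leq (shape z.1.2) z.1.2,
     SYT n (bishape z.1) z.2 & stab_k top k (ascB (sDes_tab n z.2))]]%classic.

Definition bitab_wt (T : bitableau) : {mset bool * nat} :=
  (seq_mset [seq (true, i) | i <- flatten T.1] `+`
   seq_mset [seq (false, i) | i <- flatten T.2])%mset.

(** Finiteness of the fibres is carried over from words; [xi_words] needs it to partition the pairs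
    by shape. *)
Lemma rsk_pairs top k n :
  finfib (tableau_pairs top k n) (fun z => bitab_wt z.1) /\
  words_gf (stab_words top k n) = genfun (tableau_pairs top k n) (fun z => bitab_wt
    z.1).
Proof.
pose f a := ((rsk a).1, bitab_of_word (bishape (rsk a).1) (rsk a).2).
have cnt a b r : count_mem (b, r) (rsk a).2 = nth 0 (part b (bishape (rsk a).1)) r.
  by have [_ <- _] := rsk_validP a; case: b.
have prt a : [/\ is_part (bishape (rsk a).1).1, is_part (bishape (rsk a).1).2,
    tableau leq (shape (rsk a).1.1) (rsk a).1.1 & tableau leq (shape (rsk a).1.2)
      (rsk a).1.2].
  by have [tT _ _] := rsk_validP a; have [] := (semistandardE _).1 (tT true);
    have [] := (semistandardE _).1 (tT false).
have szs a : sumn (bishape (rsk a).1).1 + sumn (bishape (rsk a).1).2 = size a.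
  by rewrite -(perm_size (perm_rsk a)) size_cat !size_map !size_flatten.
have SYTf a : SYT (size a) (bishape (rsk a).1) (f a).2.
  have [p1 p2 _ _] := prt a; have [_ _ bal] := rsk_validP a.
  by apply: bitab_of_word_SYT => //; rewrite size_rsk.
have ywf a : row_word (size a) (f a).2 = (rsk a).2.
  have [p1 p2 _ _] := prt a; apply: bitab_of_wordK => //; exact: size_rsk.
have fAB a : stab_words top k n a -> tableau_pairs top k n (f a).
  move=> [an st]; have [p1 p2 t1 t2] := prt a; rewrite -{}an in st *.
  split; [|by []|exact: SYTf|by rewrite ascB_SYT ywf asc_flags_rsk].
  by split; rewrite ?szs.
have f_inj a a' : stab_words top k n a -> stab_words top k n a' -> f a = f a' -> a = a'.
  move=> [an _] [an' _] e; apply: rsk_inj.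
  have e1 : (rsk a).1 = (rsk a').1 by case: e.
  have e2 : (rsk a).2 = (rsk a').2 by rewrite -(ywf a) -(ywf a') an an' e.
  by rewrite [LHS]surjective_pairing e1 e2 -surjective_pairing.
have f_surj z : tableau_pairs top k n z -> exists2 a, stab_words top k n a & f a = z.
  case: z => T P [[/= p1 p2 sn] [t1 t2] PP st].
  have [|a ea] := @rsk_surj (T, row_word n P).
    split=> [[]|b r|]; [by apply/semistandardE|by apply/semistandardE| |exact:
      SYT_ballot PP].
    by rewrite /= (SYT_count b r PP) //; case: b.
  have an : size a = n by rewrite -size_rsk ea size_row_word.
  exists a; last by rewrite /f ea /= SYT_bitab_of_word.
  by split=> //; rewrite -asc_flags_rsk ea -ascB_SYT.
have f_wt a : stab_words top k n a -> bitab_wt (f a).1 = seq_mset a.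
  by move=> _; rewrite /bitab_wt -seq_mset_cat; apply/perm_seq_mset/perm_rsk.
split; last by apply: (genfun_bij (f := f)) => //; apply: finfib_word.
by apply: (finfib_bij (f := f) _ fAB f_surj f_wt); apply: finfib_word.
Qed.

Lemma xi_words top n k : xi top n k = words_gf (stab_words top k n).
Proof.
have [fZ ->] := rsk_pairs top k n.
rewrite (genfun_partition (g := fun z => bishape z.1) (l := fset_set (bipart n)) fZ).
- rewrite /xi fsbig_finite; last exact: finite_bipart.
  apply: eq_big_seq => -[l m] /= /(mem_fset_set (finite_bipart n)) lm.
  have fs b p : finfib [set T : seq (seq nat) | tableau leq p T]%classic
      (fun T => seq_mset [seq ((b, i) : bool * nat) | i <- flatten T]).
    by move=> mm; apply: finite_schur.
  rewrite /schur (genfunM (fs true l) (fs false m)).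
  rewrite /cnum genfunMn; last 2 first.
  + exact: finfibX (fs true l) (fs false m).
  + by apply: sub_finite_set (finite_SYT n (l, m)) => P [].
  congr genfun; apply/seteqP; split=> -[[T1 T2] P] /=.
    move=> [[/= t1 t2] [PP st]]; have [e1 _ _] := t1; have [e2 _ _] := t2.
    by rewrite /tableau_pairs /bishape /= e1 e2.
  move=> [[_ [t1 t2] PP st] []]; move: t1 t2 PP; rewrite /bishape /= => t1 t2 PP e1 e2.
  by rewrite -e1 -e2.
- exact: fset_uniq.
by move=> z [bz _ _ _]; apply/(mem_fset_set (finite_bipart n)).
Qed.

(** * Power series in z and the two quotients *)

Section Series.
Variable R : comNzRingType.
Implicit Types a b : nat -> R.
Local Open Scope ring_scope.

Lemma zseriesB a b : zseries a - zseries b = zseries (fun n => a n - b n).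
Proof. exact: fpsP. Qed.

Lemma zseriesCM c a : fpsC unit c * zseries a = zseries (fun n => c * a n).
Proof.
have -> : fpsC unit c = zseries (fun n => if n == 0%N then c else 0).
  by apply: fpsP => m /=; rewrite -size_mset_eq0.
rewrite zseriesM; apply: fpsP => m /=; rewrite big_ord_recl big1 ?addr0 ?subn0 //.
by move=> i _; rewrite mul0r.
Qed.

End Series.

Lemma EM u : (E true u * E false u = zseries (fun n => (elemL n)%:P * u ^+ n))%R.
Proof.
rewrite /E zseriesM; apply: fpsP => m; rewrite [LHS]/= [RHS]/=; move: (size m) => n.
have -> : ((elemL n)%:P = \sum_(i < n.+1) (elem true i * elem false (n - i))%:P)%R.
  by rewrite elemLE; exact: rmorph_sum.
rewrite mulr_suml; apply: eq_bigr => i _.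
have -> : (u ^+ n = u ^+ i * u ^+ (n - i))%R by rewrite -exprD subnKC //;
  have := ltn_ord i; lia.
by rewrite polyCM; ring.
Qed.

Lemma denE : (E true 'X * E false 'X - fpsC unit 'X * E true 1 * E false 1 =
  zseries (fun n => (elemL n)%:P * ('X ^+ n - 'X)))%R.
Proof.
rewrite -mulrA !EM zseriesCM zseriesB; apply: fpsP => m /=.
by rewrite expr1n; ring.
Qed.

Lemma gamma_sum_xi top n : 0 < n ->
  (gamma_sum top n = \sum_(0 <= k < (n - ~~ top)./2.+1)
    (xi top n k)%:P * 'X^k * (1 + 'X) ^+ (n - ~~ top - 2 * k))%R.
Proof.
move=> n0; rewrite big_mkord /gamma_sum.
under [RHS]eq_bigr => k _.
  rewrite xi_words stab_words_ribbon raddf_sum -mulrA mulr_suml.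
over.
rewrite (exchange_big_dep xpredT) //=; apply: eq_big_seq => q;
  rewrite mem_bitseqs => /eqP qn.
under eq_bigl => k do rewrite stab_kE //.
rewrite /weight; have [sq /=|nsq] := boolP (stab_flags true q);
  last by rewrite big_pred0 // mul0r.
have [lq|nlq] := eqVneq (last true q) top; last first.
  by rewrite big_pred0 ?mul0r // => k; rewrite andbF.
(* A pattern contributes only to [k = count id q], and stability puts this index in the range. *)
have h : count id q < (n - ~~ top)./2.+1 by have := stab_flags_count sq;
  rewrite lq qn; lia.
rewrite (big_pred1 (Ordinal h)) => [|k] /=; last by rewrite andbT -val_eqE eq_sym.
by rewrite qn mulrC.
Qed.

Lemma gamma_sum0 : (gamma_sum true 0 = 1)%R /\ (gamma_sum false 0 = 0)%R.
Proof.
rewrite /gamma_sum !big_cons !big_nil !addr0 -[[::]]/(nseq 0 false) -elemXE elem0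
  !mulr1.
by rewrite !weight_nseq.
Qed.

Lemma gamma_series top :
  (zseries (fun n => (elem true n)%:P * if top then 'X ^+ n - 'X else 1 - 'X ^+ n) =
   (E true 'X * E false 'X - fpsC unit 'X * E true 1 * E false 1) *
   zseries (gamma_sum top))%R.
Proof.
by rewrite denE zseriesM; apply: fpsP => m /=; rewrite gamma_sum_rec.
Qed.

Lemma tofrac_div (R : idomainType) (x d g : R) : (d != 0 -> x = d * g ->
  tofrac x / tofrac d = tofrac g)%R.
Proof. by move=> d0 ->; rewrite tofracM mulrAC divff ?mul1r // tofrac_eq0. Qed.

Lemma xi_plus_series :
  (tofrac (E true 'X - fpsC unit 'X * E true 1) /
   tofrac (E true 'X * E false 'X - fpsC unit 'X * E true 1 * E false 1) =
   tofrac (zseries (fun n => \sum_(0 <= k < n./2.+1)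
     (xi_plus n k)%:P * 'X^k * (1 + 'X) ^+ (n - 2 * k))))%R.
Proof.
apply: tofrac_div; first exact: den_neq0.
have -> : (E true 'X - fpsC unit 'X * E true 1)%R = zseries (fun n =>
    (elem true n)%:P * ('X ^+ n - 'X))%R.
  by rewrite zseriesCM zseriesB; apply: fpsP => m /=; rewrite expr1n; ring.
rewrite (gamma_series true); congr (_ * _)%R; apply: fpsP => m /=; move: (size m) => n.
have [->|n0] := posnP n.
  by rewrite gamma_sum0.1 big_nat1 /xi_plus /= muln0 subn0 !expr0 !mulr1.
by rewrite gamma_sum_xi //= subn0; apply: eq_bigr => k _; rewrite /xi_plus gtn_eqF.
Qed.

Lemma xi_minus_series :
  (tofrac (E true 1 - E true 'X) /
   tofrac (E true 'X * E false 'X - fpsC unit 'X * E true 1 * E false 1) =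
   tofrac (zseries (fun n => if n == 0%N then 0 else \sum_(0 <= k < n.-1./2.+1)
     (xi_minus n k)%:P * 'X^k * (1 + 'X) ^+ (n - 1 - 2 * k))))%R.
Proof.
apply: tofrac_div; first exact: den_neq0.
have -> : (E true 1 - E true 'X)%R = zseries (fun n =>
    (elem true n)%:P * (1 - 'X ^+ n))%R.
  by rewrite zseriesB; apply: fpsP => m /=; rewrite expr1n; ring.
rewrite (gamma_series false); congr (_ * _)%R; apply: fpsP => m /=; move: (size m) => n.
have [->|n0] := posnP n; first exact: gamma_sum0.2.
by rewrite gamma_sum_xi //= subn1.
Qed.

(** * Standardization *)

Section Standardization.
Variable n : nat.
Notation x0 := (true, 0).
Implicit Types (w : {perm bool * 'I_n}) (s : n.-tuple nat) (a : seq (bool * nat)).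

(* The key orders the positions of a word by (value, sign, position): the word is
   the image of a compatible pair (w, s) iff w lists the positions by increasing
   key. *)
Definition key a (i : 'I_n) : nat := ((nth x0 a i).2.*2 + (nth x0 a i).1) * n + i.

Lemma lex_ltn m m' (i i' : 'I_n) :
  (m * n + i < m' * n + i') = (m < m') || (m == m') && (i < i').
Proof.
have hi := ltn_ord i; have hi' := ltn_ord i'.
case: (ltngtP m m') => [mm|mm|->] /=; last by rewrite ltn_add2l.
  by apply/idP; nia.
by apply/negP; nia.
Qed.

Lemma key_ltn a (i j : 'I_n) : (key a i < key a j) =
  ((nth x0 a i).2 < (nth x0 a j).2) || ((nth x0 a i).2 == (nth x0 a j).2) &&
  (~~ (nth x0 a i).1 && (nth x0 a j).1 || ((nth x0 a i).1 == (nth x0 a j).1) && (i <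
    j)).
Proof.
by rewrite /key lex_ltn; case: (nth x0 a i) (nth x0 a j) => [[] u] [[] v] /=; lia.
Qed.

Lemma key_inj a : injective (key a).
Proof.
move=> i j e; have := key_ltn a i j; have := key_ltn a j i; rewrite e ltnn.
by move=> h1 h2; apply: val_inj => /=; lia.
Qed.

(** The letter with value s_j and the sign of w(j) is placed at position |w(j)|, see
    [nth_std_word]. *)
Definition std_word (x : {perm bool * 'I_n} * n.-tuple nat) : seq (bool * nat) :=
  [seq let u := x.1^-1%g (true, i) in (u.1, tnth x.2 u.2) | i <- enum 'I_n].

Lemma size_std_word x : size (std_word x) = n.
Proof. by rewrite size_map size_enum_ord. Qed.

Lemma hyperoctE w b i : w \in hyperoct n ->
  w (b, i) = (b == (w (true, i)).1, (w (true, i)).2).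
Proof.
rewrite inE => /forallP hw; case: b; first by case: (w _) => -[].
by have /eqP := hw (true, i); rewrite /letter_opp /= => ->; case: (w _) => -[].
Qed.

Lemma hyperoct_inv w (i j : 'I_n) b : w \in hyperoct n ->
  w (true, j) = (b, i) -> w^-1%g (true, i) = (b, j).
Proof.
move=> hw e; apply: (canLR (permK w)) => /=.
by rewrite hyperoctE // e; case: (b).
Qed.

Lemma hyperoct_pos_inj w : w \in hyperoct n -> injective (fun j => (w (true, j)).2).
Proof.
move=> hw i j /= e; have e' : w (true, i) = w ((w (true, i)).1 == (w (true, j)).1, j).
  by rewrite [RHS]hyperoctE // -e; case: (w (true, i)) (w (true, j)) => -[] ? [[] ?].
by have [] := perm_inj e'.
Qed.

Lemma nth_std_word w s (j : 'I_n) : w \in hyperoct n ->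
  nth x0 (std_word (w, s)) (w (true, j)).2 = ((w (true, j)).1, tnth s j).
Proof.
move=> hw; rewrite (nth_map j) ?size_enum_ord // nth_ord_enum /=.
by rewrite (@hyperoct_inv w _ j (w (true, j)).1) // -surjective_pairing.
Qed.

Definition compatible w s : Prop :=
  sorted leq s /\ forall i j : 'I_n, i \in (sDes w).1 -> j = i.+1 :> nat ->
    tnth s i < tnth s j.

Lemma tuple_sortedP s : sorted leq s <->
  forall i j : 'I_n, j = i.+1 :> nat -> tnth s i <= tnth s j.
Proof.
split=> [/(sortedP 0) h i j e|h].
  by rewrite !(tnth_nth 0) e; apply: h; rewrite size_tuple -e.
apply/(sortedP 0) => i; rewrite size_tuple => i1.
by have := h (Ordinal (ltnW i1)) (Ordinal i1) erefl; rewrite !(tnth_nth 0).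
Qed.

(** Among equal values the key puts negative letters first and then orders by position. So a tie
    between neighbours respects the key exactly when the index is not a descent of [w]. *)
Lemma compatible_key w s : w \in hyperoct n -> compatible w s <->
  forall i j : 'I_n, j = i.+1 :> nat ->
    key (std_word (w, s)) (w (true, i)).2 < key (std_word (w, s)) (w (true, j)).2.
Proof.
move=> hw.
have desE (i j : 'I_n) : j = i.+1 :> nat -> (i \in (sDes w).1) =
    (w (true, i)).1 && ~~ (w (true, j)).1 ||
    ((w (true, i)).1 == (w (true, j)).1) && ((w (true, j)).2 < (w (true, i)).2).
  move=> e; rewrite inE; apply/existsP/idP => [[k /andP[/eqP ek]]|h].
    by rewrite !ffunE (_ : k = j) //; apply: val_inj; rewrite /= ek e.
  by exists j; rewrite !ffunE e eqxx.
have step (i j : 'I_n) : j = i.+1 :> nat ->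
  (key (std_word (w, s)) (w (true, i)).2 < key (std_word (w, s)) (w (true, j)).2) =
  (tnth s i < tnth s j) || (tnth s i == tnth s j) && (i \notin (sDes w).1).
  move=> e; rewrite key_ltn !nth_std_word // (desE i j) //=; congr (_ || _ && _).
  have ne : val (w (true, i)).2 != (w (true, j)).2.
    by apply/eqP => /val_inj /(hyperoct_pos_inj hw) ij; move: e; rewrite ij; lia.
  by case: (w (true, i)) (w (true, j)) ne => [[] u] [[] v] /=; lia.
split=> [[/tuple_sortedP h1 h2] i j e|h].
  by rewrite step //; have := h1 i j e; have := h2 i j;
    case: (i \in _) => [/(_ isT e)|]; lia.
split; first by apply/tuple_sortedP => i j e; have := h i j e; rewrite step //; lia.
by move=> i j id e; have := h i j e; rewrite step // id andbF orbF.
Qed.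

Lemma ord_homo_ltn (f : 'I_n -> nat) :
  (forall i j : 'I_n, j = i.+1 :> nat -> f i < f j) ->
  forall i j : 'I_n, (f i < f j) = (i < j).
Proof.
move=> h; have h' m (i j : 'I_n) : j = i + m.+1 :> nat -> f i < f j.
  elim: m j => [|m IH] j e; first by apply: h; rewrite e addn1.
  have lt : i + m.+1 < n by have := ltn_ord j; lia.
  by apply: ltn_trans (IH (Ordinal lt) erefl) (h _ _ _); rewrite /= e; lia.
move=> i j; have [ij|ji|/val_inj ->] := ltngtP i j; last by rewrite ltnn.
  by apply: (h' (j - i).-1); lia.
by apply/negbTE; rewrite -leqNgt ltnW //; apply: (h' (i - j).-1); lia.
Qed.

(** For neighbouring positions of equal sign, |w^-1| is ordered as the keys, hence as the values; a
    tie goes to the left position and is an ascent on both sides. *)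
Lemma ascB_std_word w s : w \in hyperoct n -> compatible w s ->
  ascB (sDes w^-1%g) = flag_set n (asc_flags gtn (std_word (w, s))).
Proof.
move=> hw /(compatible_key s hw) /ord_homo_ltn mono.
pose b := [seq ((w^-1%g (true, i)).1, val (w^-1%g (true, i)).2) | i <- enum 'I_n].
have nb (i : 'I_n) : nth x0 b i = ((w^-1%g (true, i)).1, val (w^-1%g (true, i)).2).
  by rewrite (nth_map i) ?size_enum_ord // nth_ord_enum.
have sb : size b = n by rewrite size_map size_enum_ord.
rewrite (ascB_desc (a := b) (down := gtn) (x0 := x0)) ?sb //; last 2 first.
- by move=> i; rewrite ffunE nb.
- by move=> i j; rewrite !nb.
congr flag_set; apply: (@eq_from_nth _ false);
  rewrite !size_asc_flags ?size_std_word // sb => i i_n.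
rewrite !(nth_asc_flags _ x0) ?size_std_word ?sb //.
have inv k : exists2 j, w (true, j) = ((w^-1%g (true, k)).1, k) & w^-1%g (true,
  k) = ((w^-1%g (true, k)).1, j).
  case e: (w^-1%g (true, k)) => [c j]; exists j => //=.
  have := permKV w (true, k); rewrite e hyperoctE // => -[].
  by case: (w (true, j)) c {e} => -[] x [] //= _ ->.
have nthb k (k_n : k < n) := nb (Ordinal k_n).
have nths k (k_n : k < n) : exists2 j : 'I_n,
    nth x0 (std_word (w, s)) k = ((w (true, j)).1,
      tnth s j) & nth x0 b k = ((w (true, j)).1, val j) /\ val (w (true, j)).2 = k.
  have [j e1 e2] := inv (Ordinal k_n); exists j; last by rewrite nthb e2 e1.
  by rewrite -(nth_std_word s j hw) e1.
congr (~~ _); case: ifP => [i1|_]; last by have [j -> [-> _]] := nths i i_n.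
have [j -> [-> jk]] := nths i i_n; have [j' -> [-> jk']] := nths i.+1 i1.
rewrite /desc_rel /=; have [e|//] := eqVneq (w (true, j)).1 (w (true, j')).1;
  congr (_ || _).
rewrite -mono key_ltn !nth_std_word //= e eqxx jk jk' andNb /=; lia.
Qed.

Lemma sorted_enum_ord (f : 'I_n -> nat) :
  (forall i j : 'I_n, j = i.+1 :> nat -> f i < f j) <->
  sorted ltn [seq f j | j <- enum 'I_n].
Proof.
have sz : size [seq f j | j <- enum 'I_n] = n by rewrite size_map size_enum_ord.
have nf (i : 'I_n) : nth 0 [seq f j | j <- enum 'I_n] i = f i.
  by rewrite (nth_map i) ?size_enum_ord // nth_ord_enum.
split=> [h|/(sortedP 0) h i j e].
  apply/(sortedP 0) => i; rewrite sz => i1.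
  by rewrite (nf (Ordinal (ltnW i1))) (nf (Ordinal i1)); apply: h.
by rewrite -!nf e; apply: h; rewrite sz -e.
Qed.

Lemma hyperoct_pos_onto w : w \in hyperoct n -> forall i, exists j, (w (true, j)).2 = i.
Proof.
by move=> hw i; have /codomP[j ->] := injF_onto (hyperoct_pos_inj hw) i; exists j.
Qed.

(** A word determines the keys of its positions, and the increasing listing of these keys is
    unique. *)
Lemma std_word_inj x y : x.1 \in hyperoct n -> y.1 \in hyperoct n ->
  compatible x.1 x.2 -> compatible y.1 y.2 -> std_word x = std_word y -> x = y.
Proof.
case: x y => [w s] [w' s'] /= hw hw'.
move=> /(compatible_key s hw)/sorted_enum_ord cw /(compatible_key s'
  hw')/sorted_enum_ord cw' e.
have key_eq : [seq key (std_word (w, s)) (w (true, j)).2 | j <- enum 'I_n] =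
    [seq key (std_word (w, s)) (w' (true, j)).2 | j <- enum 'I_n].
  apply: (irr_sorted_eq ltn_trans ltnn) => //; first by rewrite e.
  move=> z; apply/mapP/mapP => -[j _ ->].
    have [j' <-] := hyperoct_pos_onto hw' (w (true, j)).2.
    by exists j'; rewrite ?mem_enum.
  have [j' <-] := hyperoct_pos_onto hw (w' (true, j)).2.
  by exists j'; rewrite ?mem_enum.
have pos_eq j : (w (true, j)).2 = (w' (true, j)).2.
  by move/eq_in_map: key_eq => /(_ j (mem_enum _ _))/key_inj.
have lett_eq j : ((w (true, j)).1, tnth s j) = ((w' (true, j)).1, tnth s' j).
  by rewrite -!nth_std_word // e pos_eq.
congr pair; last by apply: eq_from_tnth => j; case: (lett_eq j).
by apply/permP => -[b j]; rewrite (hyperoctE b j hw) (hyperoctE b j hw') pos_eq;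
  case: (lett_eq j) => ->.
Qed.

Lemma std_word_surj a : size a = n ->
  exists w s, [/\ w \in hyperoct n, compatible w s & std_word (w, s) = a].
Proof.
move=> sa; pose L := sort (relpre (key a) leq) (enum 'I_n).
have uL : uniq L by rewrite sort_uniq enum_uniq.
have sL : size L = n by rewrite size_sort size_enum_ord.
pose p (j : 'I_n) := nth j L j.
have pE j0 j : p j = nth j0 L j by apply: set_nth_default; rewrite sL.
have p_inj : injective p.
  by move=> i j; rewrite [p j](pE i) => /eqP; rewrite nth_uniq ?sL // => /eqP /val_inj.
pose lett j := nth x0 a (p j).
(* On signs [==] is multiplication, [true] being +, so this extends the listing of signed positions
   to a map commuting with change of sign. *)
have f_inj : injective (fun x : bool * 'I_n => (x.1 == (lett x.2).1, p x.2)).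
  move=> [b i] [b' j] [/= + /p_inj ij]; rewrite {}ij.
  by case: b b' (lett j).1 => -[] [].
pose w := perm f_inj; pose s := [tuple (lett j).2 | j < n].
have wE x : w x = (x.1 == (lett x.2).1, p x.2) by rewrite permE.
have hw : w \in hyperoct n.
  rewrite inE; apply/forallP => -[b j]; rewrite !wE /letter_opp /= xpair_eqE eqxx andbT.
  by case: b (lett j).1 => -[].
have aE : std_word (w, s) = a.
  apply: (@eq_from_nth _ x0); rewrite size_std_word ?sa // => i i_n.
  have [j e] := hyperoct_pos_onto hw (Ordinal i_n).
  have -> : i = (w (true, j)).2 by rewrite e.
  rewrite nth_std_word // tnth_mktuple wE /= -/(lett j).
  by case: (lett j) => -[].
exists w, s; split=> //; apply/compatible_key => // i j e; rewrite aE !wE /=.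
have : sorted ltn [seq key a i | i <- L].
  rewrite ltn_sorted_uniq_leq map_inj_uniq ?uL /=; last exact: key_inj.
  by rewrite sorted_map sort_sorted // => x y; apply: leq_total.
move=> /(sortedP 0) /(_ i); rewrite size_map sL -e => /(_ (ltn_ord j)).
by rewrite !(nth_map i) ?sL // -!pE.
Qed.

End Standardization.

Lemma stab_words_Fsum top k n : words_gf (stab_words top k n) =
  (\sum_(w in hyperoct n | stab_k top k (ascB (sDes w^-1%g))) Fsum (sDes w))%R.
Proof.
pose PW := [set x : {perm bool * 'I_n} * n.-tuple nat | [/\ x.1 \in hyperoct n,
  compatible x.1 x.2 & stab_k top k (ascB (sDes x.1^-1%g))]]%classic.
pose wt (x : {perm bool * 'I_n} * n.-tuple nat) : {mset bool * nat} :=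
  seq_mset [seq ((sDes x.1).2 j, tnth x.2 j) | j : 'I_n].
have fPW : finfib PW wt.
  move=> m; pose S w := fibre [set s : n.-tuple nat | compatible w s]%classic (fun s
    => wt (w, s)) m.
  apply: (@sub_finite_set _ _ (setT `*` \bigcup_(w in setT) S w)%classic).
    by move=> [w s] [[/= _ cs _] ms]; split=> //; exists w.
  apply: finite_setX; first exact: finite_finset.
  by apply: bigcup_finite => [|w _]; [apply: finite_finset|apply: finite_Fsum].
have wtE x : PW x -> seq_mset (std_word x) = wt x.
  case: x => w s [/= hw _ _]; apply: perm_seq_mset.
  rewrite /std_word; pose pos j := (w (true, j)).2.
  have /perm_map h : perm_eq (enum 'I_n) [seq pos j | j <- enum 'I_n].
    apply: uniq_perm; rewrite ?enum_uniq //.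
      by rewrite map_inj_uniq ?enum_uniq //; apply: hyperoct_pos_inj.
    move=> i; rewrite mem_enum; apply/esym/mapP.
    by have [j <-] := hyperoct_pos_onto hw i; exists j; rewrite ?mem_enum.
  rewrite (permPl (h _ _)) -map_comp; set l := map _ _.
  have -> : l = [seq ((sDes w).2 j, tnth s j) | j : 'I_n]; last exact: perm_refl.
  apply: eq_map => j; rewrite /= /pos ffunE.
  by rewrite (@hyperoct_inv _ w _ j (w (true, j)).1) // -surjective_pairing.
transitivity (genfun PW wt).
  apply/esym; apply: (genfun_bij (f := std_word (n := n))) => //.
  - move=> [w s] [/= hw cw st]; split; first exact: size_std_word.
    by rewrite -ascB_std_word.
  - by move=> x y [hx cx _] [hy cy _]; apply: std_word_inj.
  move=> a [sa st]; have [w [s [hw cw e]]] := std_word_surj sa.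
  by exists (w, s) => //; split=> //; rewrite (ascB_std_word hw cw) e.
pose cond w := (w \in hyperoct n) && stab_k top k (ascB (sDes w^-1%g)).
rewrite (genfun_partition (g := fst) (l := [seq w <- index_enum _ | cond w]) fPW).
- rewrite big_filter; apply: eq_bigr => w /andP[hw st]; apply/esym.
  apply: (genfun_bij (f := fun s => (w, s))) => //.
  + by move=> m; apply: finite_Fsum.
  + by move=> s s' _ _ [].
  by move=> [w' s] [[/= _ cs _] e]; exists s; rewrite -?e.
- by rewrite filter_uniq ?index_enum_uniq.
by move=> [w s] [/= hw _ st]; rewrite mem_filter mem_index_enum /cond hw st.
Qed.

Local Open Scope ring_scope.

Theorem corollary4p4 :
  let t : fps unit {poly xyseries} := fpsC unit 'X in
  let den := E true 'X * E false 'X - t * E true 1 * E false 1 in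
  [/\ tofrac (E true 'X - t * E true 1) / tofrac den =
        tofrac (zseries (fun n => \sum_(0 <= k < n./2.+1)
          (xi_plus n k)%:P * 'X^k * (1 + 'X) ^+ (n - 2 * k))),
      tofrac (E true 1 - E true 'X) / tofrac den =
        tofrac (zseries (fun n => if n == 0%N then 0 else
          \sum_(0 <= k < (n.-1)./2.+1)
            (xi_minus n k)%:P * 'X^k * (1 + 'X) ^+ (n - 1 - 2 * k))) &
      forall n k : nat, (1 <= n)%N ->
        xi_plus n k = \sum_(w in hyperoct n | stab_k true k (ascB (sDes w^-1%g)))
                        Fsum (sDes w)
        /\
        xi_minus n k = \sum_(w in hyperoct n | stab_k false k (ascB (sDes w^-1%g)))
                        Fsum (sDes w)].
Proof.
split; [exact: xi_plus_series|exact: xi_minus_series|].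
move=> n k n0; rewrite /xi_plus /xi_minus (gtn_eqF n0) !xi_words.
by split; apply: stab_words_Fsum.
Qed.
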